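(* Let $(M_n,S_n)_{n\ge0}$ be a nontrivial Markov random walk with positive recurrent driving chain on the countable state space $\mathcal{S}$, and let $({}^{\#}M_n,{}^{\#}S_n)_{n\ge0}$ be its dual. For a Markov random walk $(M_n,S_n)_{n\ge 0}$, $i\in\mathcal{S}$ and $\rho\in[0,1]$, consider the assertions: (a) Under $\mathbb{P}_i$, as $n\to\infty$, $\frac{1}{n}\sum_{k=1}^n\mathbf{1}_{\{S_k>0\}}\xrightarrow{d}AS(\rho)$ and $\frac{1}{n}\sum_{k=1}^n\mathbf{1}_{\{S_k\le0\}}\xrightarrow{d}AS(1-\rho)$. (b) $\lim_{n\to\infty}\frac1n\sum_{k=1}^n\mathbb{P}_i(S_{\tau_k(i)}>0)$ exists and equals $\rho$. (c) $\lim_{n\to\infty}\frac1n\sum_{k=1}^n\mathbb{P}_i(S_k>0)$ exists and equals $\rho$. (d) $\lim_{n\to\infty}\mathbb{P}_i(S_n>0)$ exists and equals $\rho$. If, for some $\rho\in[0,1]$ and some (respectively, all) $i\in\mathcal{S}$, the Markov random walk $(M_n,S_n)_{n\ge0}$ satisfies (a)--(c), then its dual $({}^{\#}M_n,{}^{\#}S_n)_{n\ge0}$ satisfies (a)--(c) for the same $\rho$ and the same $i$ (respectively, all $i\in\mathcal{S}$), where $S_k$ and $\tau_k(i)$ are replaced by ${}^{\#}S_k$ and ${}^{\#}\tau_k(i)$. The same is true with (a)--(d) in place of (a)--(c).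
   Context: Markov random walk (MRW): $\mathbf{M}=(M_n)_{n\ge0}$ (the driving chain) is a positive recurrent Markov chain on a countable state space $\mathcal{S}$ with transition matrix $P=(p_{ij})_{i,j\in\mathcal{S}}$ and unique stationary distribution $\pi=(\pi_i)_{i\in\mathcal{S}}$ (so it is irreducible). $S_0=0$, $S_n=\sum_{l=1}^n X_l$, where the real random variables $X_1,X_2,\dots$ are conditionally independent given $\mathbf{M}$ and, for a stochastic kernel $K$ from $\mathcal{S}^2$ to $\mathbb{R}$, $\mathbb{P}((X_1,\dots,X_n)\in\cdot\mid M_0=i_0,\dots,M_n=i_n)=K_{i_0i_1}\otimes\dots\otimes K_{i_{n-1}i_n}$ for all $n\ge1$ and $i_0,\dots,i_n\in\mathcal{S}$. $\mathbb{P}_i:=\mathbb{P}(\cdot\mid M_0=i)$. The MRW is null-homologous if there is a function $g:\mathcal{S}\to\mathbb{R}$ with $X_n=g(M_n)-g(M_{n-1})$ $\mathbb{P}_i$-a.s. for all $n\ge1$ and all $i\in\mathcal{S}$; otherwise it is called nontrivial. $(\tau_n(i))_{n\ge1}$ is the sequence of successive return epochs of $\mathbf{M}$ to $i$ (at times $\ge1$). Dual: $({}^{\#}M_n,{}^{\#}S_n)_{n\ge0}$ is the MRW whose driving chain $({}^{\#}M_n)_{n\ge0}$ has transition matrix ${}^{\#}P=(\pi_jp_{ji}/\pi_i)_{i,j\in\mathcal{S}}$ and whose increments ${}^{\#}X_n={}^{\#}S_n-{}^{\#}S_{n-1}$ (with ${}^{\#}S_0=0$) have conditional law ${}^{\#}K_{ij}=K_{ji}$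 given ${}^{\#}M_{n-1}=i$, ${}^{\#}M_n=j$. One takes ${}^{\#}M_0=M_0$, so that ${}^{\#}M_0=i$ under $\mathbb{P}_i$; ${}^{\#}\tau_n(i)$ are the successive return epochs of $({}^{\#}M_n)_{n\ge0}$ to $i$. Generalized arcsine laws: $AS(0):=\delta_0$, $AS(1):=\delta_1$, and for $\theta\in(0,1)$, $AS(\theta)$ is the distribution with density $\frac{\sin(\pi\theta)}{\pi}\frac{1}{x^{1-\theta}(1-x)^{\theta}}\mathbf{1}_{(0,1)}(x)$ (here $\pi$ is the number). $\xrightarrow{d}$ denotes convergence in distribution. *)

(* Defs.v *)
From HB Require Import structures.
From mathcomp Require Import all_boot all_order all_algebra.
From mathcomp Require Import all_classical all_reals all_analysis.
From mathcomp Require Import measurable_realfun.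

Set Implicit Arguments.
Unset Strict Implicit.
Unset Printing Implicit Defensive.

Import Order.TTheory GRing.Theory Num.Theory.
Import numFieldNormedType.Exports.

Local Open Scope classical_set_scope.
Local Open Scope ring_scope.

Section arcsine_law.
Context {R : realType}.
Implicit Types (theta x : R).

(* Set to 0 outside 0 < theta < 1 so that it is nonnegative for every theta. *)
Definition arcsine_pdf theta : R -> R :=
  if 0 < theta < 1 then
    (fun x => sin (pi * theta) / pi *
              (x `^ (1 - theta) * (1 - x) `^ theta)^-1) \_ `]0, 1[
  else cst 0.

Lemma arcsine_pdf_ge0 theta x : 0 <= arcsine_pdf theta x.
Proof.
rewrite /arcsine_pdf; case: ifPn => // /andP[t0 t1].
apply: restrict_ge0 => y _; apply: mulr_ge0.
  apply: divr_ge0; last exact: pi_ge0.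
  apply: sin_ge0_pi; apply/andP; split; first by rewrite mulr_ge0 ?pi_ge0 ?ltW.
  by rewrite -[leRHS]mulr1 ler_wpM2l ?pi_ge0 ?ltW.
by rewrite invr_ge0 mulr_ge0// powR_ge0.
Qed.

Lemma measurable_arcsine_pdf theta :
  measurable_fun [set: R] (arcsine_pdf theta).
Proof.
rewrite /arcsine_pdf; case: ifPn => // _.
apply/measurable_restrict => //; apply: measurable_funTS.
apply: measurable_funM => //.
under eq_fun do rewrite -powR_inv1 ?mulr_ge0 ?powR_ge0//.
apply: (measurableT_comp (measurable_powR _)).
apply: measurable_funM; first exact: measurable_powR.
apply: (measurableT_comp (measurable_powR _)).
exact: measurable_funB.
Qed.

Definition arcsine_law theta (A : set (measurableTypeR R)) : \bar R :=
  if theta == 0 then \d_(0 : measurableTypeR R) A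
  else if theta == 1 then \d_(1 : measurableTypeR R) A
  else (\int[lebesgue_measure]_(x in A) (arcsine_pdf theta x)%:E)%E.

Section arcsine_measure.
Variable theta : R.

Let arcsine0 : arcsine_law theta set0 = 0%E.
Proof.
rewrite /arcsine_law; case: (theta == 0); [|case: (theta == 1)];
  [exact: measure0|exact: measure0|exact: integral_set0].
Qed.

Let arcsine_ge0 A : (0 <= arcsine_law theta A)%E.
Proof.
rewrite /arcsine_law; case: (theta == 0); [|case: (theta == 1)];
  [exact: measure_ge0|exact: measure_ge0|].
by apply: integral_ge0 => x _; rewrite lee_fin arcsine_pdf_ge0.
Qed.

Let arcsine_sigma_additive : semi_sigma_additive (arcsine_law theta).
Proof.
rewrite /arcsine_law; case: (theta == 0); [|case: (theta == 1)];
  [exact: measure_semi_sigma_additive|exact: measure_semi_sigma_additive|].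
move=> /= F mF tF mUF; apply: cvg_toP.
  apply: ereal_nondecreasing_is_cvgn => m n mn.
  apply: lee_sum_nneg_natr => // k _ _; apply: integral_ge0 => /= x _.
  by rewrite lee_fin arcsine_pdf_ge0.
rewrite ge0_integral_bigcup//=.
- by apply/measurable_funTS/measurableT_comp => //; exact: measurable_arcsine_pdf.
- by move=> x _; rewrite lee_fin arcsine_pdf_ge0.
Qed.

HB.instance Definition _ := isMeasure.Build _ _ _ (arcsine_law theta)
  arcsine0 arcsine_ge0 arcsine_sigma_additive.

End arcsine_measure.
End arcsine_law.

Definition cvg_in_distribution (R : realType) (d : measure_display)
    (Omega : measurableType d) (P : probability Omega R)
    (Y : nat -> Omega -> R) (mu : {measure set (measurableTypeR R) -> \bar R}) :
    Prop :=
  forall f : R -> R, continuous f -> (exists B : R, forall x, `|f x| <= B) ->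
    (fun n => 'E_P[fun w => f (Y n w)]%E) @ \oo --> (\int[mu]_x (f x)%:E)%E.

Section transition_matrices.
Context {R : realType} {S : countType}.
Implicit Types p : S -> S -> R.

Definition transition_matrix p : Prop :=
  (forall i j, 0 <= p i j) /\
  (forall i, \esum_(j in [set: S]) (p i j)%:E = 1%E).

Definition stationary_distribution p (pi_ : S -> R) : Prop :=
  [/\ forall i, 0 <= pi_ i,
      \esum_(i in [set: S]) (pi_ i)%:E = 1%E &
      forall j, \esum_(i in [set: S]) (pi_ i * p i j)%:E = (pi_ j)%:E].

Definition unique_stationary_distribution p (pi_ : S -> R) : Prop :=
  stationary_distribution p pi_ /\
  forall pi', stationary_distribution p pi' -> pi' = pi_.

Definition dual_matrix p (pi_ : S -> R) : S -> S -> R :=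
  fun i j => pi_ j * p j i / pi_ i.

(* Since S is countable, a stochastic kernel from S^2 to R is just a family of
   probability measures on R indexed by pairs of states. *)
Definition dual_kernel (K : S -> S -> probability (measurableTypeR R) R) :
    S -> S -> probability (measurableTypeR R) R :=
  fun i j => K j i.

End transition_matrices.

Section return_epochs.
Context {S : countType}.
Implicit Types (x : nat -> S) (i : S).

Definition next_visit x i (m : nat) : option nat :=
  if pselect (exists k, (m < k)%N && (x k == i)) is left ex
  then Some (ex_minn ex) else None.

(* [None] encodes the value +oo; epoch 0 is time 0, so that the epochs of index
   n >= 1 are those of the successive visits to i at times >= 1. *)
Fixpoint return_epoch x i (n : nat) : option nat :=
  if n is n'.+1 then obind (next_visit x i) (return_epoch x i n') else Some 0%N.

End return_epochs.

(* [Pr i] is the law P_i, under which the driving chain starts at i. *)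
Section markov_random_walk.
Context {R : realType} {S : countType} {d : measure_display}
        {Omega : measurableType d}.
Variables (Pr : S -> probability Omega R).
Variables (M : nat -> Omega -> S) (X : nat -> Omega -> R).

Definition path_event (n : nat) (s : nat -> S) : set Omega :=
  [set w | forall k, (k <= n)%N -> M k w = s k].

(* Increments are indexed from 0: [X n] is X_{n+1}, the increment between the
   times n and n+1.  The last clause is the conditional law of (X_1, ..., X_n)
   given M_0 = s 0, ..., M_n = s n, on measurable rectangles, multiplied by the
   probability of the conditioning event. *)
Definition markov_random_walk (p : S -> S -> R)
    (K : S -> S -> probability (measurableTypeR R) R) : Prop :=
  [/\ forall n j, measurable [set w | M n w = j],
      forall n, measurable_fun [set: Omega] (X n),
      forall i n s, Pr i (path_event n s) =
        ((s 0%N == i)%:R * \prod_(k < n) p (s k) (s k.+1))%:E &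
      forall i n s (A : nat -> set R), (forall k, measurable (A k)) ->
        Pr i (path_event n s `&`
              [set w | forall k, (k < n)%N -> A k (X k w)]) =
        (Pr i (path_event n s) * \prod_(k < n) K (s k) (s k.+1) (A k))%E].

Definition walk (n : nat) (w : Omega) : R := \sum_(l < n) X l w.

Definition mean_return_time (i : S) : \bar R :=
  (\int[Pr i]_w
     (if return_epoch (M ^~ w) i 1 is Some m then m%:R%:E else +oo))%E.

Definition irreducible_chain : Prop :=
  forall i j, exists n, (0 < Pr i [set w | M n w = j])%E.

Definition positive_recurrent_chain : Prop :=
  irreducible_chain /\ forall i, (mean_return_time i < +oo)%E.

Definition null_homologous : Prop :=
  exists g : S -> R, forall n i,
    {ae Pr i, forall w, X n w = g (M n.+1 w) - g (M n w)}.

Definition nontrivial : Prop := ~ null_homologous.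

Definition walk_at_return_gt0 (i : S) (k : nat) : set Omega :=
  [set w | if return_epoch (M ^~ w) i k is Some m then 0 < walk m w
           else false].

Definition assertion_a (i : S) (rho : R) : Prop :=
  cvg_in_distribution (Pr i)
    (fun n w => n%:R^-1 * \sum_(1 <= k < n.+1) (0 < walk k w)%R%:R)
    (arcsine_law rho) /\
  cvg_in_distribution (Pr i)
    (fun n w => n%:R^-1 * \sum_(1 <= k < n.+1) (walk k w <= 0)%R%:R)
    (arcsine_law (1 - rho)).

Definition assertion_b (i : S) (rho : R) : Prop :=
  (fun n => n%:R^-1 *
     \sum_(1 <= k < n.+1) fine (Pr i (walk_at_return_gt0 i k))) @ \oo --> rho.

Definition assertion_c (i : S) (rho : R) : Prop :=
  (fun n => n%:R^-1 *
     \sum_(1 <= k < n.+1) fine (Pr i [set w | 0 < walk k w])) @ \oo --> rho.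

Definition assertion_d (i : S) (rho : R) : Prop :=
  (fun n => fine (Pr i [set w | 0 < walk n w])) @ \oo --> rho.

Definition assertions_ac (i : S) (rho : R) : Prop :=
  [/\ assertion_a i rho, assertion_b i rho & assertion_c i rho].

Definition assertions_ad (i : S) (rho : R) : Prop :=
  [/\ assertion_a i rho, assertion_b i rho, assertion_c i rho &
      assertion_d i rho].

End markov_random_walk.

(* Main.v *)
From HB Require Import structures.
Require Import Defs.
From mathcomp Require Import all_boot all_order all_algebra.
From mathcomp Require Import all_classical all_reals all_analysis.
From mathcomp Require Import measurable_realfun zify ring lra.

(* Cut a trajectory started at i at its successive returns to i. Reversing every
   cycle in place, without changing the order of the cycles, turns the walk into
   its dual, because pi telescopes along a cycle. Hence the return times to i and
   the positions S at these times have the same joint law for both walks, which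
   settles (b).

   Let V_n be the position at the last return to i before time n. The signs of
   S_n and V_n differ only if the displacement since that return exceeds |V_n|.
   This displacement is tight since the mean return time is finite, whereas for a
   nontrivial walk P_i(M_n = i, |S_n| <= K) tends to 0 for every K. Therefore
   P_i(S_n > 0) - P_i(V_n > 0) tends to 0, and so does the mean difference of the
   occupation fractions of S and V, for both walks. As V has the same law for
   both, (a), (c) and (d) pass from the walk to its dual.

   For the escape to infinity, suppose first that the law of S_m on {M_m = i} is
   not a point mass for some m. The limiting concentration function of S_n on
   {M_n = i} is then asymptotically attained along two displacements that are
   arbitrarily far apart, so it doubles on a wider interval, hence vanishes.
   Otherwise S_n = c n on {M_n = i}, and c = 0 would make the walk
   null-homologous. *)

Set Implicit Arguments.
Unset Strict Implicit.
Unset Printing Implicit Defensive.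

Import Order.TTheory GRing.Theory Num.Theory.
Import numFieldNormedType.Exports.

Local Open Scope classical_set_scope.
Local Open Scope ring_scope.

(** * Trajectories *)

(** The two walks live on unrelated probability spaces. Both are replaced by their laws on one space
    of trajectories, where equality in law is checked on cylinders and only the products
    [p j k * K j k A] matter; duality becomes the identity [kappa' j k A = pi_ k * kappa k j A / pi_
    j].

    Reversal preserves probabilities only for paths that lead from i back to i. The unfinished piece
    after the last return is out of its reach, and so (a), (c) and (d) are compared through V_n,
    which is a function of completed cycles. The length of that piece is controlled by the tail of
    the return time, which agrees for both walks, being one minus a sum of first-return
    probabilities.

    No moments of the increments are available and the walk may be arithmetic, so the escape to
    infinity cannot rest on a limit theorem; the concentration argument works from recurrence and
    the Markov property. Stopping times are avoided: first and last visits are summed over their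
    possible values, and the Markov property at fixed times suffices. *)

Section trajectory_space.
Context {R : realType} {S : countType}.

Definition cylinder (n : nat) (s : nat -> S) (A : nat -> set R) :
    set (nat -> S * R) :=
  [set w | (forall k, (k <= n)%N -> (w k).1 = s k) /\
           (forall k, (k < n)%N -> A k (w k).2)].

Definition measurable_family (A : nat -> set R) := forall k, measurable (A k).

(** The empty set is included to obtain a pi-system: cylinders with conflicting states are
    disjoint. *)
Definition cylinders : set_system (nat -> S * R) :=
  [set B | B = set0 \/ exists n s A, measurable_family A /\ B = cylinder n s A].

(* The index i only makes the type pointed, as required of a measurableType. *)
Definition pointed_trajectory (i : S) : Type := nat -> S * R.

HB.instance Definition _ i := Choice.on (pointed_trajectory i).
HB.instance Definition _ i :=
  isPointed.Build (pointed_trajectory i) (fun=> (i, 0)).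

Definition trajectory (i : S) : Type :=
  @g_sigma_algebraType (pointed_trajectory i) cylinders.

Lemma cylindersI : setI_closed cylinders.
Proof.
have wlg n s A m s' A' : (n <= m)%N -> measurable_family A -> measurable_family A' ->
    cylinders (cylinder n s A `&` cylinder m s' A').
  move=> nm mA mA'; have [ss'|ss'] := pselect (forall k, (k <= n)%N -> s k = s' k).
    right; exists m, s', (fun k => if (k < n)%N then A k `&` A' k else A' k); split.
      by move=> k; case: ifP => // _; exact: measurableI.
    apply/seteqP; split => w.
      move=> [[h1 h2] [h3 h4]]; split => // k km; case: ifP => kn; last exact: h4.
      by split; [exact: h2|exact: h4].
    move=> [h1 h2]; split; split => // k.
    - by move=> kn; rewrite h1 ?ss'// (leq_trans kn).
    - by move=> kn; have := h2 _ (leq_trans kn nm); rewrite kn => -[].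
    - by move=> km; have := h2 _ km; case: ifP => // _ [].
  left; apply/seteqP; split => // w [[h1 _] [h2 _]]; apply: ss' => k kn.
  by rewrite -h1// h2// (leq_trans kn).
move=> B C [->|[n [s [A [mA ->]]]]]; first by rewrite set0I; left.
move=> [->|[m [s' [A' [mA' ->]]]]]; first by rewrite setI0; left.
have [nm|/ltnW mn] := leqP n m; first exact: wlg.
by rewrite setIC; exact: wlg.
Qed.

End trajectory_space.
Arguments trajectory {R S} i.

(** * Decomposition along a map with countably many values *)

Section measure_fibers.
Context {R : realType} {S : countType} {d} {T : measurableType d}.
Variable f : T -> S.
Hypothesis mf : forall j, measurable [set w | f w = j].

Let fiber (B : set T) k := B `&` [set w | pickle (f w) = k].

Let fiberP B k :
  (exists2 j, pickle j = k & fiber B k = B `&` [set w | f w = j]) \/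
  fiber B k = set0.
Proof.
have [[j jk]|nk] := pselect (exists j : S, pickle j = k); last first.
  by right; apply/seteqP; split => // w [_ /= fk]; apply: nk; exists (f w).
left; exists j => //; rewrite /fiber -jk; congr (_ `&` _).
by apply/seteqP; split => [w /= e|w /= ->//]; exact: (pcan_inj pickleK).
Qed.

Let bigcup_fiber B : B = \bigcup_k fiber B k.
Proof.
by apply/seteqP; split => [w Bw|w [k _ []//]]; exists (pickle (f w)).
Qed.

Let measurable_fiber B k : measurable B -> measurable (fiber B k).
Proof. by move=> mB; have [[j _ ->]|->//] := fiberP B k; exact: measurableI. Qed.

Let trivIset_fiber B : trivIset setT (fiber B).
Proof.
apply/trivIsetP => k l _ _ /eqP kl; apply/seteqP; split => // w [[_ /= a] [_ /= b]].
by apply: kl; rewrite -a -b.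
Qed.

Lemma eq_measure_fibers (m1 m2 : {measure set T -> \bar R}) (B : set T) :
  measurable B ->
  (forall j, m1 (B `&` [set w | f w = j]) = m2 (B `&` [set w | f w = j])) ->
  m1 B = m2 B.
Proof.
move=> mB e; rewrite (bigcup_fiber B) !measure_semi_bigcup//;
  try (by move=> k; exact: measurable_fiber);
  try (by rewrite -bigcup_fiber).
by apply: eq_eseriesr => k _; have [[j _ ->]|->] := fiberP B k; rewrite ?measure0.
Qed.

Lemma measure_fibers_eq0 (m : {measure set T -> \bar R}) (B : set T) :
  measurable B -> (forall j, m (B `&` [set w | f w = j]) = 0%E) -> m B = 0%E.
Proof. by move=> mB e; rewrite (@eq_measure_fibers m mzero B). Qed.

Lemma measurable_fibers (B : S -> set T) : (forall j, measurable (B j)) ->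
  measurable [set w | B (f w) w].
Proof.
move=> mB; rewrite (_ : [set w | _] = \bigcup_j ([set w | f w = j] `&` B j)).
  by apply: countable_bigcupT_measurable => // j; exact: measurableI.
apply/seteqP; split => [w Bw|w [j _ [/= <-//]]].
by exists (f w).
Qed.

End measure_fibers.

Section trajectory_theory.
Context {R : realType} {S : countType} {i0 : S}.
Local Notation T := (@trajectory R S i0).
Implicit Types (w : T) (n k : nat) (s : nat -> S) (A : nat -> set R) (B : set T).

Definition state n w : S := (w n).1.
Definition increment n w : R := (w n).2.
Definition position n w : R := \sum_(l < n) increment l w.
Definition shift n (w : T) : T := fun k => w (n + k)%N.

Lemma measurable_cylinder n s A : measurable_family A ->
  measurable (cylinder n s A : set T).
Proof. by move=> mA; apply: sub_sigma_algebra; right; exists n, s, A. Qed.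

Lemma measurable_state n j : measurable [set w | state n w = j].
Proof.
(* Elements of [seq S] encode the possible state prefixes. There are countably many of them, so the
   event is a countable union of cylinders. *)
rewrite (_ : [set w | _] =
   \bigcup_(s in [set: seq S]) (if nth i0 s n == j then cylinder n (nth i0 s) (fun=> setT) else set0)).
  apply: countable_bigcupT_measurable => // s; case: ifP => // _.
  by apply: measurable_cylinder => k.
apply/seteqP; split => w.
  move=> /= wj; exists (mkseq (fun k => state k w) n.+1) => //.
  rewrite nth_mkseq//= wj eqxx; split => // k kn.
  by rewrite nth_mkseq.
by move=> [s _]; case: eqP => // <- [h _]; rewrite /= /state h.
Qed.
Hint Resolve measurable_state : core.

Lemma measurable_increment n : measurable_fun [set: T] (increment n).
Proof.
move=> _ B mB; rewrite setTI (_ : _ @^-1` B =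
   \bigcup_(s in [set: seq S])
     (cylinder n.+1 (nth i0 s) (fun k => if k == n then B else setT))).
  apply: countable_bigcupT_measurable => // s.
  by apply: measurable_cylinder => k; case: ifP.
apply/seteqP; split => w.
  move=> /= wB; exists (mkseq (fun k => state k w) n.+2) => //; split => // k kn.
    by rewrite nth_mkseq.
  by case: eqP => // ->.
by move=> [s _ [_ /(_ n)]]; rewrite ltnSn eqxx; exact.
Qed.

Lemma measurable_position n : measurable_fun [set: T] (position n).
Proof. by apply: measurable_sum => l; exact: measurable_increment. Qed.

Lemma measurable_into_trajectory d (U : measurableType d) (f : U -> T) :
  (forall n j, measurable [set u | state n (f u) = j]) ->
  (forall n, measurable_fun [set: U] (fun u => increment n (f u))) ->
  measurable_fun [set: U] f.
Proof.
move=> ms mi; apply: (@measurability _ _ _ T _ _ cylinders) => //.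
move=> _ [_ [->|[n [s [A [mA ->]]]]] <-]; first by rewrite preimage_set0 setI0.
rewrite setTI (_ : _ @^-1` _ =
  \bigcap_(k in `I_n.+1) [set u | state k (f u) = s k] `&`
  \bigcap_(k in `I_n) ((fun u => increment k (f u)) @^-1` A k)).
  apply: measurableI; apply: bigcap_measurableType => k _ //.
  by rewrite -[X in measurable X]setTI; exact: mi.
by apply/seteqP; split => u [h1 h2]; split.
Qed.

Lemma measurable_shift n : measurable_fun [set: T] (shift n).
Proof.
apply: measurable_into_trajectory => [k j|k]; first exact: measurable_state.
exact: measurable_increment.
Qed.

Lemma position_shift n m w :
  position (n + m) w = position n w + position m (shift n w).
Proof. by rewrite /position big_split_ord. Qed.

Lemma state_shift n m w : state m (shift n w) = state (n + m) w.
Proof. by []. Qed.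

(* Longer cylinders suffice, as a short one is a countable union of long ones. *)
Lemma eq_measure_cylinders N (m1 m2 : {measure set T -> \bar R}) :
  (m1 setT < +oo)%E ->
  (forall n s A, (N <= n)%N -> measurable_family A ->
    m1 (cylinder n s A) = m2 (cylinder n s A)) ->
  forall B, measurable B -> m1 B = m2 B.
Proof.
move=> m1oo e; have {}e n s A : measurable_family A ->
    m1 (cylinder n s A) = m2 (cylinder n s A).
  move=> mA; have [k] := ubnP (N - n)%N; elim: k n s A mA => // k IH n s A mA nk.
  have [Nn|nN] := leqP N n; first exact: e.
  apply: (@eq_measure_fibers _ _ _ _ (state n.+1)) => //.
    exact: measurable_cylinder.
  move=> j.
  have -> : cylinder n s A `&` [set w | state n.+1 w = j] =
    cylinder n.+1 (fun k => if (k <= n)%N then s k else j)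
      (fun k => if (k < n)%N then A k else setT) :> set T.
    apply/seteqP; split => w.
      move=> [[h1 h2] /= h3]; split => l.
        by rewrite leq_eqVlt ltnS => /orP[/eqP ->|ln]; rewrite ?ltnn// ln h1.
      by move=> _; case: ifP => // /h2.
    move=> [h1 h2]; split; last by have /= := h1 _ (leqnn _); rewrite ltnn.
    split => l ln; first by rewrite h1 ?ln// (leq_trans ln).
    by have := h2 l; rewrite ln; apply; rewrite ltnW.
  by apply: IH; [move=> l; case: ifP|lia].
have eT : m1 setT = m2 setT.
  apply: (@eq_measure_fibers _ _ _ _ (state 0)) => // j.
  rewrite setTI (_ : [set w | _] = cylinder 0 (fun=> j) (fun=> setT) :> set T).
    by apply: e => k.
  by apply/seteqP; split => w /=; [move=> h; split => // k; rewrite leqn0 => /eqP ->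
                                  |move=> [/(_ 0%N) + _]; exact].
(* In general the whole space is not a cylinder, as a cylinder fixes the initial state. Adding it
   supplies the cover that [measure_unique] asks for, and [eT] the equality on it. *)
pose G : set_system T := [set B | B = setT \/ cylinders B].
have GE : measurable = <<s G>> :> set_system T.
  apply/seteqP; split; first by apply: sub_smallest2r => [|B]; [exact: smallest_sigma_algebra|right].
  apply: smallest_sub; first exact: sigma_algebra_measurable.
  by move=> B [->|GB]; [exact: measurableT|exact: sub_sigma_algebra].
apply: (@measure_unique _ _ _ G (fun=> setT)) => //.
- move=> B C [->|cB]; first by rewrite setTI.
  by move=> [->|cC]; [rewrite setIT; right|right; exact: cylindersI].
- by move=> _; left.
- by rewrite bigcup_const//; exists 0%N.
- move=> B [->//|[->|[n [s [A [mA ->]]]]]]; first by rewrite !measure0.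
  exact: e.
Qed.

End trajectory_theory.

(** * Events determined by the steps up to time n *)

Section stopped_events.
Context {R : realType} {S : countType} {i0 : S}.
Local Notation T := (@trajectory R S i0).
Implicit Types (w : T) (n k : nat) (s : nat -> S) (A : nat -> set R) (B : set T).

Definition agree n w w' :=
  (forall k, (k <= n)%N -> state k w = state k w') /\
  (forall k, (k < n)%N -> increment k w = increment k w').

(** Stands for membership in the sigma-algebra of the first n steps, expressed on trajectories so
    that closure properties are pointwise; measurability is assumed separately. *)
Definition past n B := forall w w', agree n w w' -> B w -> B w'.

Lemma agree_sym n w w' : agree n w w' -> agree n w' w.
Proof. by move=> [h1 h2]; split=> k kn; [rewrite h1|rewrite h2]. Qed.

Lemma agree_le m n w w' : (m <= n)%N -> agree n w w' -> agree m w w'.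
Proof.
move=> mn [h1 h2]; split => k kn; first by rewrite h1// (leq_trans kn).
by rewrite h2// (leq_trans kn).
Qed.

Lemma agree_position n w w' : agree n w w' -> position n w = position n w'.
Proof. by move=> [_ h]; apply: eq_bigr => l _; exact: h. Qed.

(** Freezing the trajectory at time n serves to recognize the past: an event of [past n] is its own
    preimage under [stop n]. *)
Definition stop n (w : T) : T := fun k =>
  (state (minn k n) w, if (k < n)%N then increment k w else 0).

Lemma agree_stop n w : agree n w (stop n w).
Proof.
split => k kn; first by rewrite /state/= (minn_idPl kn).
by rewrite /increment/= kn.
Qed.

Lemma measurable_stop n : measurable_fun [set: T] (stop n).
Proof.
apply: measurable_into_trajectory => [k j|k].
  exact: (measurable_state (minn k n) j).
rewrite /increment/=; case: (k < n)%N => //; exact: (measurable_increment k).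
Qed.

Lemma past_cylinder n s A : past n (cylinder n s A).
Proof.
move=> w w' [h1 h2] [h3 h4]; split => k kn.
  by have := h1 k kn; rewrite /state => <-; exact: h3.
by have := h2 k kn; rewrite /increment => <-; exact: h4.
Qed.

Lemma past_state n k j : (k <= n)%N -> past n [set w | state k w = j].
Proof. by move=> kn w w' [h _] /= <-; rewrite h. Qed.

Lemma pastI n B B' : past n B -> past n B' -> past n (B `&` B').
Proof.
by move=> pB pB' w w' ww' [h h']; split; [exact: pB ww' h|exact: pB' ww' h'].
Qed.

Lemma pastC n B : past n B -> past n (~` B).
Proof. by move=> pB w w' ww' nB B'; apply: nB; exact: pB (agree_sym ww') B'. Qed.

Lemma past_le m n B : (m <= n)%N -> past m B -> past n B.
Proof. by move=> mn pB w w' ww'; apply: pB; exact: agree_le ww'. Qed.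

Lemma past_bigcap (I : Type) (D : set I) n (F : I -> set T) :
  (forall x, D x -> past n (F x)) -> past n (\bigcap_(x in D) F x).
Proof. by move=> h w w' ww' Fw x Dx; apply: (h x Dx w w' ww'); exact: Fw. Qed.

Lemma eq_measure_stopped n (m1 m2 : {measure set T -> \bar R}) :
  (m1 setT < +oo)%E ->
  (forall s A, measurable_family A ->
    m1 (cylinder n s A) = m2 (cylinder n s A)) ->
  forall B, measurable B -> past n B -> m1 B = m2 B.
Proof.
move=> m1oo e B mB pB.
have BE : stop n @^-1` B = B.
  apply/seteqP; split => w /=; last exact: pB (agree_stop n w).
  exact: pB (agree_sym (agree_stop n w)).
have ms := measurable_stop n.
suff : forall B, measurable B ->
    pushforward m1 (stop n) B = pushforward m2 (stop n) B.
  by move=> /(_ _ mB); rewrite /pushforward BE.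
apply: (@eq_measure_cylinders _ _ _ n) => // k s A nk mA.
change (m1 (stop n @^-1` cylinder k s A) = m2 (stop n @^-1` cylinder k s A)).
(* Beyond time n a frozen trajectory has a constant state and zero increments. If the long cylinder
   allows this, its preimage is the cylinder of length n; otherwise the preimage is empty. *)
have [h|h] := pselect ((forall l, (n <= l <= k)%N -> s l = s n) /\
                       (forall l, (n <= l < k)%N -> A l 0)).
  rewrite (_ : _ @^-1` _ = cylinder n s A); first exact: e.
  case: h => h1 h2.
  apply/seteqP; split => w [h3 h4]; split => l ln.
  - by have := h3 l (leq_trans ln nk); rewrite /= (minn_idPl ln).
  - by have := h4 l (leq_trans ln nk); rewrite /= ln.
  - have [lln|/ltnW nl] := leqP l n; rewrite /= /state.
      by rewrite (minn_idPl lln) h3.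
    by rewrite (minn_idPr nl) h3// h1// nl.
  - rewrite /=; case: ifP => ll; first exact: h4.
    by apply: h2; rewrite leqNgt ll.
rewrite (_ : _ @^-1` _ = set0) ?measure0//; apply/seteqP; split => // w [h3 h4].
apply: h; split => l /andP[nl lk].
  have := h3 l lk; rewrite /= (minn_idPr nl) => <-.
  by have := h3 n (leq_trans nl lk); rewrite /= minnn.
by have := h4 l lk; rewrite /= ltnNge nl.
Qed.

End stopped_events.

(** * Probabilities as real numbers *)

Section fine_probability.
Context {R : realType} {d} {T : measurableType d} (P : probability T R).
Implicit Types A B : set T.

Definition prob A : R := fine (P A).

Lemma probE A : measurable A -> P A = (prob A)%:E.
Proof. by move=> mA; rewrite fineK//; exact: fin_num_measure. Qed.

Lemma prob_ge0 A : 0 <= prob A.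
Proof. exact: fine_ge0. Qed.

Lemma prob0 : prob set0 = 0.
Proof. by rewrite /prob measure0. Qed.

Lemma probT : prob setT = 1.
Proof. by rewrite /prob probability_setT. Qed.

Lemma le_prob A B : measurable A -> measurable B -> A `<=` B -> prob A <= prob B.
Proof.
by move=> mA mB AB; rewrite -lee_fin -!probE//; apply: le_measure; rewrite ?inE.
Qed.

Lemma prob_le1 A : measurable A -> prob A <= 1.
Proof. by move=> mA; rewrite -probT; exact: le_prob. Qed.

Lemma probU A B : measurable A -> measurable B -> A `&` B = set0 ->
  prob (A `|` B) = prob A + prob B.
Proof.
move=> mA mB AB; apply: EFin_inj; rewrite EFinD -!probE//; last exact: measurableU.
exact: measureU.
Qed.

Lemma prob_leU A B : measurable A -> measurable B ->
  prob (A `|` B) <= prob A + prob B.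
Proof.
move=> mA mB; rewrite -lee_fin EFinD -!probE//; last exact: measurableU.
exact: measureU2.
Qed.

Lemma probC A : measurable A -> prob (~` A) = 1 - prob A.
Proof.
move=> mA; apply: EFin_inj.
by rewrite -probE ?probability_setC ?probE//; exact: measurableC.
Qed.

Lemma probDI A B : measurable A -> measurable B ->
  prob A = prob (A `\` B) + prob (A `&` B).
Proof.
move=> mA mB; rewrite -probU//; first by rewrite -setDDr setDv setD0.
- exact: measurableD.
- exact: measurableI.
- by apply/seteqP; split => // w [[_ nB] [_ /nB]].
Qed.

Lemma prob_bigU n (F : nat -> set T) : (forall k, (k < n)%N -> measurable (F k)) ->
  prob (\big[setU/set0]_(k < n) F k) <= \sum_(k < n) prob (F k).
Proof.
move=> mF; rewrite -lee_fin -probE; last by apply: bigsetU_measurable => k _; exact: mF.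
rewrite (le_trans (Boole_inequality _ mF))// -sumEFin lee_sum// => k _.
by rewrite -(probE (mF _ (ltn_ord k))) lexx.
Qed.

Lemma prob_nonincreasing_cvg0 (F : nat -> set T) :
  (forall k, measurable (F k)) -> (forall k, F k.+1 `<=` F k) ->
  P (\bigcap_k F k) = 0%E -> prob (F n) @[n --> \oo] --> 0.
Proof.
move=> mF dF F0; apply: fine_cvg; rewrite -[X in _ --> X]F0.
apply: nonincreasing_cvg_mu => //.
- by rewrite ltey_eq fin_num_measure.
- exact: bigcapT_measurable.
- by apply/nonincreasing_seqP => n; apply/subsetPset; exact: dF.
Qed.

Lemma prob_bigcup_eq0 (F : nat -> set T) :
  (forall k, measurable (F k)) -> (forall k, prob (F k) = 0) ->
  prob (\bigcup_k F k) = 0.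
Proof.
move=> mF F0; rewrite /prob (_ : P _ = 0%E)//; apply/eqP.
have mU : measurable (\bigcup_k F k) by exact: bigcupT_measurable.
rewrite eq_le measure_ge0 andbT (le_trans (generalized_Boole_inequality _ mF mU))//.
by rewrite eseries0 => // k _ _; exact: (etrans (probE (mF k)) (congr1 EFin (F0 k))).
Qed.

End fine_probability.

(** * Markov property *)

Section markov_property.
Context {R : realType} {S : countType} {i0 : S}.
Local Notation T := (@trajectory R S i0).
Local Notation sh n := (@shift R S i0 n).
Implicit Types (w : T) (n k : nat) (s : nat -> S) (A : nat -> set R) (B : set T).
Variables (L : S -> probability T R) (kappa : S -> S -> set R -> R).

(* [kappa j k A] stands for [p j k * K j k A]; only cylinder probabilities matter. *)
Definition chain_law := forall i n s A, measurable_family A ->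
  L i (cylinder n s A) =
    ((s 0%N == i)%:R * \prod_(k < n) kappa (s k) (s k.+1) (A k))%:E.

Hypothesis LP : chain_law.

(** The second sequence takes over at index n: for states this is the shared endpoint, for
    increments the first step after time n. *)
Definition glue (U : Type) n (s s' : nat -> U) k :=
  if (k < n)%N then s k else s' (k - n)%N.

Lemma cylinder_shift n m s (s' : nat -> S) A (A' : nat -> set R) : s' 0%N = s n ->
  cylinder n s A `&` sh n @^-1` cylinder m s' A' =
  cylinder (n + m)%N (glue n s s') (glue n A A') :> set T.
Proof.
move=> s0; rewrite /glue; apply/seteqP; split => w.
  move=> [[h1 h2] [h3 h4]]; split => k kn.
    have [|nk] := ltnP k n; first by move=> /ltnW; exact: h1.
    by have := h3 (k - n)%N; rewrite /shift subnKC//; apply; rewrite leq_subLR.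
  have [|nk] := ltnP k n; first exact: h2.
  by have := h4 (k - n)%N; rewrite /shift subnKC//; apply; rewrite ltn_subLR.
move=> [h1 h2]; split; split => k kn.
- have := h1 k (leq_trans kn (leq_addr _ _)); case: (ltnP k n) => // nk ->.
  have -> : k = n by apply/eqP; rewrite eqn_leq kn.
  by rewrite subnn s0.
- by have := h2 k (leq_trans kn (leq_addr _ _)); rewrite kn.
- have := h1 (n + k)%N; rewrite leq_add2l => /(_ kn); rewrite /shift => ->.
  by rewrite ltnNge leq_addr/= addKn.
- have := h2 (n + k)%N; rewrite ltn_add2l => /(_ kn).
  by rewrite /shift ltnNge leq_addr/= addKn.
Qed.

Lemma measurable_glue n A A' : measurable_family A -> measurable_family A' ->
  measurable_family (glue n A A').
Proof. by move=> mA mA' k; rewrite /glue; case: ifP. Qed.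

Lemma chain_law_start i : L i [set w : T | state 0 w = i] = 1%E.
Proof.
have := LP i 0 (fun=> i) (A := fun=> setT); rewrite eqxx big_ord0 mul1r => <-//.
congr (L i _); apply/seteqP; split => w /=; last by move=> [/(_ 0%N) h _]; exact: h.
by move=> h; split => // k; rewrite leqn0 => /eqP ->.
Qed.

Lemma markov_cylinder i n s A B : measurable_family A -> measurable B ->
  L i (cylinder n s A `&` sh n @^-1` B) = (L i (cylinder n s A) * L (s n) B)%E.
Proof.
move=> mA mB; have mE := measurable_cylinder n s mA : measurable (_ : set T).
have ms := @measurable_shift R S i0 n.
rewrite setIC (probE (L i) mE).
(* As functions of [B] both sides are finite measures, an image of a restriction of [L i] and a
   multiple of [L (s n)]. On cylinders the product of the [kappa] splits at n. *)
pose r := NngNum (prob_ge0 (L i) (cylinder n s A : set T)).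
suff : forall B, measurable B ->
    pushforward (mrestr (L i) mE) (sh n) B = mscale r (L (s n)) B by exact.
apply: (@eq_measure_cylinders _ _ _ 0) => //.
  change (L i (sh n @^-1` setT `&` cylinder n s A) < +oo)%E.
  by rewrite preimage_setT setTI ltey_eq fin_num_measure.
move=> m s' A' _ mA'.
change (L i (sh n @^-1` cylinder m s' A' `&` cylinder n s A) =
  ((prob (L i) (cylinder n s A))%:E * L (s n) (cylinder m s' A'))%E).
rewrite -probE// setIC !LP// -EFinM.
have [s0|s0] := eqVneq (s' 0%N) (s n); last first.
  rewrite mul0r mulr0 (_ : _ `&` _ = set0) ?measure0//.
  apply/seteqP; split => // w [[h1 _] [h2 _]]; move/eqP: s0; apply.
  by rewrite -h2// -h1// /shift addn0.
rewrite cylinder_shift// LP; last exact: measurable_glue.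
congr _%:E; rewrite mul1r -mulrA; congr (_ * _).
  rewrite /glue; case: ifP => // /negbT; rewrite -leqNgt leqn0 => /eqP n0.
  by rewrite sub0n s0 n0.
rewrite big_split_ord/=; congr (_ * _); apply: eq_bigr => k _; rewrite /glue.
  rewrite ltn_ord; case: (ltnP k.+1 n) => // nk.
  have e : k.+1 = n by apply/eqP; rewrite eqn_leq nk ltn_ord.
  by rewrite e subnn s0.
by rewrite !ltnNge leq_addr (leq_trans (leq_addr k n))// addKn -addnS addKn.
Qed.

Lemma markov_ereal i n j B B' : measurable B -> past n B -> measurable B' ->
  L i (B `&` [set w : T | state n w = j] `&` sh n @^-1` B') =
  (L i (B `&` [set w : T | state n w = j]) * L j B')%E.
Proof.
move=> mB pB mB'.
have mS := @measurable_state R S i0 n j.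
have mE : measurable ([set w : T | state n w = j] `&` sh n @^-1` B').
  apply: measurableI => //; rewrite -[X in measurable X]setTI.
  exact: measurable_shift.
(* Now [B'] is fixed and both sides are measures in the past event, which reduces to cylinders of
   length n by stopping. *)
pose r := NngNum (prob_ge0 (L j) B').
rewrite -setIA muleC (probE (L j) mB').
suff : mrestr (L i) mE B = mscale r (mrestr (L i) mS) B by exact.
apply: (@eq_measure_stopped _ _ _ n) => //.
  change (L i (setT `&` ([set w : T | state n w = j] `&` sh n @^-1` B')) < +oo)%E.
  by rewrite setTI ltey_eq fin_num_measure.
move=> s A mA.
change (L i (cylinder n s A `&` ([set w : T | state n w = j] `&` sh n @^-1` B')) =
  ((prob (L j) B')%:E * L i (cylinder n s A `&` [set w : T | state n w = j]))%E).
rewrite -probE// setIA; have [sj|sj] := eqVneq (s n) j.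
  rewrite (_ : cylinder n s A `&` _ = cylinder n s A).
    by rewrite markov_cylinder// sj muleC.
  by apply/seteqP; split => w [] // h1 h2; split => //=; rewrite -sj; exact: h1.
rewrite (_ : cylinder n s A `&` _ = set0).
  by rewrite set0I !measure0 mule0.
apply/seteqP; split => // w [[h1 _] /= h2]; move/eqP: sj; apply.
by rewrite -h2 /state h1.
Qed.

Local Notation P i := (prob (L i)).

Lemma markov i n j B B' : measurable B -> past n B -> measurable B' ->
  P i (B `&` [set w : T | state n w = j] `&` sh n @^-1` B') =
  P i (B `&` [set w : T | state n w = j]) * P j B'.
Proof.
move=> mB pB mB'; rewrite /prob markov_ereal// fineM//; apply: fin_num_measure => //.
by apply: measurableI => //; exact: measurable_state.
Qed.

(** The future event may depend on the position at time n, which the Markov property for a fixed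
    event does not cover. On [E] the pair of position and shifted trajectory has a product law, as
    seen on rectangles, so the probability is an integral of section probabilities, each at most
    [q]. *)
Lemma markov_position_le i n j B (Z : set (measurableTypeR R * T)) (q : R) :
  0 <= q -> measurable B -> past n B -> measurable Z ->
  (forall w, B w -> state n w = j -> P j [set w' : T | Z (position n w, w')] <= q) ->
  P i (B `&` [set w : T | state n w = j] `&` [set w : T | Z (position n w, sh n w)]) <=
    q * P i (B `&` [set w : T | state n w = j]).
Proof.
move=> q0 mB pB mZ Zq; set E := B `&` _.
have mE : measurable E by apply: measurableI => //; exact: measurable_state.
have ms := @measurable_shift R S i0 n.
have mp : measurable_fun setT (position n : T -> measurableTypeR R).
  exact: measurable_position.
have mps : measurable_fun setT
    (fun w : T => (position n w : measurableTypeR R, sh n w)).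
  exact: measurable_fun_pair.
have mpsZ : measurable [set w : T | Z (position n w, sh n w)].
  by rewrite -[X in measurable X]setTI; exact: mps.
pose m1 := pushforward (mrestr (L i) mE) (position n : T -> measurableTypeR R).
pose nu := pushforward (mrestr (L i) mE)
  (fun w : T => (position n w : measurableTypeR R, sh n w)).
have mxZ := measurable_fun_xsection (L j) mZ.
have m1T : m1 setT = L i E.
  change (L i (position n @^-1` setT `&` E) = L i E).
  by rewrite preimage_setT setTI.
have nuZ : nu Z = (\int[m1]_y L j (xsection Z y))%E.
  change (nu Z = (m1 \x L j)%E Z).
  pose G : set_system (measurableTypeR R * T) :=
    [set A `*` B | A in measurable & B in measurable].
  apply: (@measure_unique _ _ _ G (fun=> setT)) => //.
  - exact: measurable_prod_measurableType.
  - move=> _ _ [A1 mA1 [B1 mB1 <-]] [A2 mA2 [B2 mB2 <-]].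
    exists (A1 `&` A2); first exact: measurableI.
    by exists (B1 `&` B2); [exact: measurableI|rewrite setXI].
  - by move=> _; exists setT => //; exists setT => //; rewrite setXTT.
  - by rewrite bigcup_const//; exists 0%N.
  - move=> _ [C mC [D mD <-]].
    transitivity (m1 C * L j D)%E; last first.
      by symmetry; apply: product_measure1E.
    change (L i ((position n @^-1` C `&` sh n @^-1` D) `&` E) =
            (L i (position n @^-1` C `&` E) * L j D)%E).
    have mC' : measurable (position n @^-1` C : set T).
      by rewrite -[X in measurable X]setTI; exact: mp.
    rewrite setIAC /E (setIA (_ @^-1` C)) markov_ereal//; first exact: measurableI.
    apply: pastI => // w w' ww' /=; by rewrite (agree_position ww').
  - move=> _.
    change (L i (setT `&` E) < +oo)%E.
    by rewrite setTI ltey_eq fin_num_measure.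
have mY : measurable [set y | (L j (xsection Z y) <= q%:E)%E].
  rewrite -[X in measurable X]setTI; exact: emeasurable_fun_infty_c.
(* The bound on sections is known only at positions reached on [E]; these carry all the mass of
   [m1], the law of the position restricted to [E]. *)
have m1Y : {ae m1, forall y, setT y -> (L j (xsection Z y) <= q%:E)%E}.
  exists (~` [set y | (L j (xsection Z y) <= q%:E)%E]); split.
  - exact: measurableC.
  - change (L i (position n @^-1` (~` [set y | (L j (xsection Z y) <= q%:E)%E]) `&` E) = 0%E).
    rewrite (_ : _ `&` _ = set0) ?measure0//; apply/seteqP; split => // w [/= h [Bw Mw]].
    apply: h; rewrite probE ?lee_fin; last exact: measurable_xsection.
    have := Zq w Bw Mw; congr (_ <= _); congr (prob _ _).
    by apply/seteqP; split => w'; rewrite /xsection /= in_setE.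
  - by move=> y h /= h'; apply: h => _.
rewrite -lee_fin EFinM -!probE//; last exact: measurableI.
rewrite (_ : L i (E `&` _) = nu Z); last by rewrite setIC.
rewrite nuZ -m1T -integral_cst//.
by apply: ae_ge0_le_integral => // *; rewrite lee_fin.
Qed.

End markov_property.

(** * Visits to a fixed state *)

Section returns.
Context {R : realType} {S : countType} {i0 : S}.
Local Notation T := (@trajectory R S i0).
Local Notation sh n := (@shift R S i0 n).
Implicit Types (w : T) (n k m J : nat).
Variables (L : S -> probability T R) (kappa : S -> S -> set R -> R) (i : S).
Hypothesis LP : chain_law L kappa.
Local Notation P := (prob (L i)).

Lemma measurable_position_in n (A : set R) : measurable A ->
  measurable [set w : T | A (position n w)].
Proof.
by move=> mA; rewrite -[X in measurable X]setTI; exact: measurable_position.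
Qed.

Lemma past_position_in n k (A : set R) : (k <= n)%N ->
  past n [set w : T | A (position k w)].
Proof. by move=> kn w w' ww' /=; rewrite (agree_position (agree_le kn ww')). Qed.

Lemma measurable_shift_preimage n (B : set T) : measurable B ->
  measurable (sh n @^-1` B).
Proof. by move=> mB; rewrite -[X in measurable X]setTI; exact: measurable_shift. Qed.

(** [avoids 1 a] says that the first return takes longer than a; the sum of its probabilities over a
    is the mean return time. *)
Definition avoids m J : set T :=
  [set w | forall k, (m <= k <= J)%N -> state k w <> i].

Lemma avoidsE m J :
  avoids m J = \bigcap_(k in [set k | (m <= k <= J)%N]) ~` [set w : T | state k w = i].
Proof. by apply/seteqP; split => w h k; exact: h. Qed.

Lemma measurable_avoids m J : measurable (avoids m J).
Proof.
rewrite avoidsE; apply: bigcap_measurableType => k _; apply: measurableC.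
exact: measurable_state.
Qed.

Lemma past_avoids m J : past J (avoids m J).
Proof.
rewrite avoidsE; apply: past_bigcap => k /andP[_ kJ]; apply: pastC.
exact: past_state.
Qed.

Lemma avoidsS m J : (m <= J.+1)%N ->
  avoids m J `\` [set w : T | state J.+1 w = i] = avoids m J.+1.
Proof.
move=> mJ; apply/seteqP; split => w.
  move=> [h1 h2] k /andP[mk]; rewrite leq_eqVlt => /orP[/eqP->//|kJ].
  by apply: h1; rewrite mk.
move=> h; split; last by apply: h; rewrite mJ leqnn.
by move=> k /andP[mk kJ]; apply: h; rewrite mk leqW.
Qed.

Lemma shift_avoids m J k w :
  (sh k @^-1` avoids m J) w <-> avoids (k + m) (k + J) w.
Proof.
split => h l /andP[l1 l2].
  have := h (l - k)%N; rewrite state_shift subnKC; last by lia.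
  by apply; lia.
by rewrite state_shift; apply: h; lia.
Qed.

Lemma le_prob_start (B B' : set T) : measurable B -> measurable B' ->
  (forall w, state 0 w = i -> B w -> B' w) -> P B <= P B'.
Proof.
move=> mB mB' BB'.
have m0 : measurable [set w : T | state 0 w = i] by exact: measurable_state.
have P0 : P [set w : T | state 0 w = i] = 1.
  by rewrite /prob (chain_law_start LP).
rewrite (probDI (L i) mB m0) -[leRHS]add0r; apply: lerD.
  apply: (@le_trans _ _ (P (~` [set w : T | state 0 w = i]))).
    apply: le_prob; [exact: measurableD|exact: measurableC|by move=> w []].
  by rewrite probC// P0 subrr.
apply: le_prob => //; first exact: measurableI.
by move=> w [? ?]; exact: BB'.
Qed.

(* The last visit to i before time m starts an excursion lasting beyond J. *)
Lemma prob_avoids_le m J : (m <= J)%N ->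
  P (avoids m J) <= \sum_(k < m) P (avoids 1 (J - k)).
Proof.
move=> mJ.
pose F k := [set w : T | state k w = i] `&` sh k @^-1` avoids 1 (J - k).
have mF k : measurable (F k).
  apply: measurableI; first exact: measurable_state.
  by apply: measurable_shift_preimage; exact: measurable_avoids.
apply: (@le_trans _ _ (P (\big[setU/set0]_(k < m) F k))).
  apply: le_prob_start => [||w w0 wa]; first exact: measurable_avoids.
    by apply: bigsetU_measurable => k _; exact: mF.
  have [k [km wk mx]] : exists k, [/\ (k < m)%N, state k w = i &
      forall l, (k < l < m)%N -> state l w <> i].
    have m0 : (0 < m)%N.
      by rewrite lt0n; apply/eqP => m0; apply: (wa 0%N) => //; rewrite m0.
    have ex : exists k, (k < m)%N && (state k w == i) by exists 0%N; rewrite m0 w0 eqxx.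
    have ub k : (k < m)%N && (state k w == i) -> (k <= m)%N by move=> /andP[/ltnW].
    case: (ex_maxnP ex ub) => k /andP[km /eqP wk] mx; exists k; split => // l /andP[kl lm] wl.
    by have := mx l; rewrite lm wl eqxx => /(_ isT); rewrite leqNgt kl.
  rewrite -bigcup_mkord; exists k => //; split => //.
  apply/shift_avoids => l /andP[kl lJ]; have [lm|ml] := ltnP l m.
    by apply: mx; rewrite lm andbT; lia.
  by apply: wa; rewrite ml/=; lia.
apply: (le_trans (prob_bigU _ (fun k _ => mF k))); apply: ler_sum => k _.
have := markov LP i (n := k) i (B := setT) (B' := avoids 1 (J - k)) measurableT.
rewrite setTI => ->//; last exact: measurable_avoids.
by rewrite ler_piMl ?prob_ge0// prob_le1//; exact: measurable_state.
Qed.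

Definition visit_prob n (A : set R) :=
  P ([set w : T | state n w = i] `&` [set w : T | A (position n w)]).

Lemma visit_prob_ge0 n A : 0 <= visit_prob n A.
Proof. exact: prob_ge0. Qed.

Lemma le_visit_prob n A A' : measurable A -> measurable A' -> A `<=` A' ->
  visit_prob n A <= visit_prob n A'.
Proof.
move=> mA mA' AA'; apply: le_prob; last by move=> w [h /AA'].
- by apply: measurableI; [exact: measurable_state|exact: measurable_position_in].
- by apply: measurableI; [exact: measurable_state|exact: measurable_position_in].
Qed.

Lemma visit_prob_past_le n k (B : set T) (A : set R) q : (k <= n)%N -> 0 <= q ->
  measurable A -> measurable B -> past k B ->
  (forall w, B w -> state k w = i ->
     visit_prob (n - k) [set y | A (position k w + y)] <= q) ->
  P (B `&` [set w : T | state k w = i] `&`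
     ([set w : T | state n w = i] `&` [set w : T | A (position n w)])) <=
    q * P (B `&` [set w : T | state k w = i]).
Proof.
move=> kn q0 mA mB pB hq.
pose Z : set (measurableTypeR R * T) :=
  [set z | state (n - k) z.2 = i /\ A (z.1 + position (n - k) z.2)].
have mZ : measurable Z.
  rewrite (_ : Z = (snd @^-1` [set w : T | state (n - k) w = i]) `&`
     ((fun z : measurableTypeR R * T => z.1 + position (n - k) z.2) @^-1` A)) //.
  apply: measurableI; rewrite -[X in measurable X]setTI.
    by apply: measurable_snd => //; exact: measurable_state.
  apply: measurable_funD => //; apply: measurableT_comp => //.
  exact: measurable_position.
have := markov_position_le LP i (n := k) (j := i) q0 mB pB mZ hq.
congr (_ <= _); congr P; congr (_ `&` _).
apply/seteqP; split => w; rewrite /Z /= state_shift -position_shift subnKC//.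
Qed.

(* Condition on the first visit to i from time m on. *)
Lemma visit_prob_first_visit_le m J n (A Y : set R) q1 q2 : (m <= J <= n)%N ->
  0 <= q1 -> 0 <= q2 -> measurable A -> measurable Y ->
  (forall y, Y y -> visit_prob (n - m) [set z | A (y + z)] <= q1) ->
  (forall k y, (m <= k <= J)%N -> visit_prob (n - k) [set z | A (y + z)] <= q2) ->
  visit_prob n A <= q1 * visit_prob m Y + q2 * (1 - visit_prob m Y) +
                    P (avoids m J).
Proof.
move=> mJn q10 q20 mA mY h1 h2.
set U := [set w : T | state n w = i] `&` [set w : T | A (position n w)].
have mst k : measurable [set w : T | state k w = i] by exact: measurable_state.
have mU : measurable U by apply: measurableI => //; exact: measurable_position_in.
have mpY := measurable_position_in m mY.
have mav J' : measurable (avoids m J') by exact: measurable_avoids.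
(* Induction on the length a of the stretch searched for a visit. Visits found so far, other than
   those at time m inside [Y], are charged [q2]; the part of the event without any visit yet is kept
   as a remainder. *)
suff H a : (m + a <= J)%N -> P U <= q1 * visit_prob m Y +
    q2 * (1 - visit_prob m Y - P (avoids m (m + a))) + P (U `&` avoids m (m + a)).
  have := H (J - m)%N; rewrite subnKC; last by case/andP: mJn.
  move=> /(_ (leqnn _)) {}H; apply: (le_trans H); apply: lerD.
    by rewrite lerD2l ler_wpM2l// gerBl prob_ge0.
  by apply: le_prob => //; exact: measurableI.
elim: a => [_|a IH]; last first.
  rewrite addnS => aJ; apply: (le_trans (IH (ltnW aJ))).
  have mam : (m <= (m + a).+1)%N by lia.
  have e1 := probDI (L i) (mav (m + a)%N) (mst (m + a).+1).
  have e2 := probDI (L i) (measurableI _ _ mU (mav (m + a)%N)) (mst (m + a).+1).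
  rewrite avoidsS// in e1.
  have e3 : U `&` avoids m (m + a) `\` [set w : T | state (m + a).+1 w = i] =
      U `&` avoids m (m + a).+1 by rewrite -setIDA avoidsS.
  rewrite e3 in e2.
  have : P (U `&` avoids m (m + a) `&` [set w : T | state (m + a).+1 w = i]) <=
      q2 * P (avoids m (m + a) `&` [set w : T | state (m + a).+1 w = i]).
    rewrite -setIA setIC; apply: visit_prob_past_le => //; first by lia.
      exact: past_le (leqnSn _) (@past_avoids m (m + a)).
    by move=> w _ _; apply: h2; lia.
  by rewrite e1 e2; lra.
rewrite addn0.
have avm : avoids m m = ~` [set w : T | state m w = i].
  apply/seteqP; split => w h; first by apply: h; rewrite !leqnn.
  by move=> k; rewrite -eqn_leq => /eqP <-.
have e0 := probDI (L i) mU (mst m).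
have e1 := probDI (L i) (measurableI _ _ mU (mst m)) mpY.
have e2 := probDI (L i) (mst m) mpY.
have b1 : P (U `&` [set w : T | state m w = i] `&` [set w | Y (position m w)]) <=
    q1 * visit_prob m Y.
  rewrite /visit_prob (setIC [set w | state m w = i]) -setIA setIC.
  rewrite (setIC [set w : T | state m w = i]).
  apply: visit_prob_past_le => //; first by lia.
    exact: past_position_in.
  by move=> w Yw _; exact: h1.
have b2 : P (U `&` [set w : T | state m w = i] `\` [set w | Y (position m w)]) <=
    q2 * P ([set w : T | state m w = i] `\` [set w | Y (position m w)]).
  rewrite !setDE (setIC [set w | state m w = i] (~` _)) -setIA setIC.
  rewrite (setIC [set w : T | state m w = i]).
  apply: visit_prob_past_le => //; first by lia.
  - exact: measurableC.
  - by apply: pastC; exact: past_position_in.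
  - by move=> w _ _; apply: h2; lia.
rewrite avm probC// -setDE e0 e1.
have e3 : P [set w : T | state m w = i] =
    P ([set w : T | state m w = i] `\` [set w | Y (position m w)]) + visit_prob m Y.
  exact: e2.
by rewrite [in 1 - P _]e3; nra.
Qed.

End returns.

(** * Escape to infinity *)

Section concentration.
Context {R : realType} {S : countType} {i0 : S}.
Local Notation T := (@trajectory R S i0).
Local Notation sh n := (@shift R S i0 n).
Implicit Types (w : T) (n k m J : nat).
Variables (L : S -> probability T R) (kappa : S -> S -> set R -> R) (i : S).
Hypothesis LP : chain_law L kappa.
Local Notation av := (@avoids R S i0 i).
Hypothesis recurrent : forall e : R, 0 < e ->
  exists a0, forall a, (a0 <= a)%N -> prob (L i) (av 1 a) <= e.
Local Notation P := (prob (L i)).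
Local Notation u := (visit_prob L i).

Lemma avoids_small m e : 0 < e ->
  exists J0, forall J, (J0 <= J)%N -> P (av m J) <= e.
Proof.
move=> e0; have m0 : 0 < m.+1%:R :> R by rewrite ltr0n.
have [a0 ha] := recurrent (divr_gt0 e0 m0).
exists (a0 + m)%N => J aJ; have mJ : (m <= J)%N by lia.
apply: (le_trans (prob_avoids_le i LP mJ)).
apply: (@le_trans _ _ (\sum_(k < m) e / m.+1%:R)).
  by apply: ler_sum => k _; apply: ha; have := ltn_ord k; lia.
rewrite sumr_const card_ord -[leLHS]mulr_natr -mulrA ler_piMr//; first exact: ltW.
by rewrite ler_pdivrMl// mulr1 ler_nat.
Qed.

(** An asymptotic bound, uniform in x, on the concentration function of S_n restricted to the event
    that the chain is in i at time n. *)
Definition eventually_le (K q : R) :=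
  exists N, forall n x, (N <= n)%N -> u n `[x, x + K] <= q.

Lemma shift_itv (x K y : R) :
  [set z | `[x, x + K]%classic (y + z)] = `[x - y, x - y + K]%classic.
Proof.
by apply/seteqP; split => z; rewrite /= !in_itv/= => /andP[? ?]; apply/andP; split; lra.
Qed.

(** For y1 in [[- C, t]] and y2 in [[t', C]] the windows [[x - y, x - y + K]] are disjoint and lie
    in one window of length [K + C + C]. They cannot both carry more than [lam - e], since
    [q' < 2 * (lam - e)]. Hence one of the two bands consists of displacements whose windows carry
    at most [lam - e], and arriving in that band at time m, which has probability at least [alpha],
    lowers the bound. *)
Lemma eventually_le_improve m (alpha t t' C K q' lam e : R) :
  0 < alpha -> 0 <= K -> t + K < t' ->
  alpha <= u m `[- C, t] -> alpha <= u m `[t', C] ->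
  eventually_le (K + C + C) q' -> (forall eta, 0 < eta -> eventually_le K (lam + eta)) ->
  0 < e -> 0 <= lam -> q' < 2 * (lam - e) ->
  eventually_le K (lam - alpha * e / 2).
Proof.
move=> al0 K0 tt' u1 u2 [N' hN'] hlam e0 lam0 q'l.
have q'0 : 0 <= q' by rewrite (le_trans _ (hN' N' 0 (leqnn _)))// visit_prob_ge0.
(* The gain is [alpha * e]. A quarter of it pays for exceeding [lam] at later visits, a quarter for
   trajectories that miss i for too long, and half remains. *)
have ale : 0 < alpha * e / 4 by rewrite divr_gt0// mulr_gt0.
have [N hN] := hlam _ ale; have [J0 hJ0] := avoids_small m ale.
exists (N + N' + m + J0)%N => n x nn.
have [n1 n2 nm] : [/\ (J0 <= n - N)%N, (m <= n - N <= n)%N & (N' <= n - m)%N].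
  by clear - nn; split; lia.
have nk k : (m <= k <= n - N)%N -> (N <= n - k)%N by clear - nn; lia.
have key (Y : set R) : measurable Y -> alpha <= u m Y ->
    (forall y, Y y -> u (n - m) `[x - y, x - y + K] <= lam - e) ->
    u n `[x, x + K] <= lam - alpha * e / 2.
  move=> mY aY hY.
  have := visit_prob_first_visit_le (i := i) LP (m := m) (J := n - N) (n := n)
    (A := `[x, x + K]%classic) (Y := Y) (q1 := lam - e) (q2 := lam + alpha * e / 4).
  move=> /(_ _ _ _ _ mY); have := hJ0 (n - N)%N.
  set r := P (av m (n - N)) => hr H.
  have {hr} : r <= alpha * e / 4 by exact: hr.
  have {H} : u n `[x, x + K] <= (lam - e) * u m Y + (lam + alpha * e / 4) * (1 - u m Y) + r.
    apply: H => //; [lra|lra| |].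
      by move=> y Yy; rewrite shift_itv; exact: hY.
    by move=> k y kn; rewrite shift_itv; apply: hN; exact: nk.
  clear - aY ale al0 e0 => H hr.
  have := ler_pM (ltW al0) (ltW e0) aY (lexx e).
  have : 0 <= u m Y * (alpha * e) by rewrite mulr_ge0 ?visit_prob_ge0// ltW// mulr_gt0.
  by nra.
have [h1|h1] := pselect (forall y, `[- C, t]%classic y ->
    u (n - m) `[x - y, x - y + K] <= lam - e); first exact: (key _ _ u1).
have [h2|h2] := pselect (forall y, `[t', C]%classic y ->
    u (n - m) `[x - y, x - y + K] <= lam - e); first exact: (key _ _ u2).
exfalso; move/existsNP : h1 => [y1 /not_implyP[]]; move/existsNP : h2 => [y2 /not_implyP[]].
rewrite /= !in_itv/= => /andP[y2a y2b] /negP; rewrite -ltNge => h2.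
move=> /andP[y1a y1b] /negP; rewrite -ltNge => h1.
have := hN' (n - m)%N (x - C).
move=> /(_ nm); apply/negP; rewrite -ltNge (lt_le_trans q'l)//.
apply: (@le_trans _ _ (u (n - m) `[x - y2, x - y2 + K] + u (n - m) `[x - y1, x - y1 + K])).
  by move: h1 h2; lra.
have mst : measurable [set w : T | state (n - m) w = i] by exact: measurable_state.
have mp (a b : R) : measurable [set w : T | `[a, b]%classic (position (n - m) w)].
  exact: measurable_position_in.
rewrite /visit_prob -probU; [|exact: measurableI|exact: measurableI|].
  apply: le_prob.
  - by apply: measurableU; exact: measurableI.
  - exact: measurableI.
  - by move=> w [] [wi] /=; rewrite !in_itv/= => /andP[? ?]; split => //=;
      rewrite ?in_itv/=; apply/andP; split; lra.
apply/seteqP; split => // w [[_ /=] + [_ /=]]; rewrite !in_itv/= => /andP[? ?] /andP[? ?].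
lra.
Qed.

Let bounds (K : R) := [set q | eventually_le K q].

Let has_inf_bounds K : has_inf (bounds K).
Proof.
split; last by exists 0 => q [N /(_ N 0 (leqnn _))]; apply: le_trans; exact: visit_prob_ge0.
exists 1; exists 0%N => n x _; apply: prob_le1; apply: measurableI.
  exact: measurable_state.
exact: measurable_position_in.
Qed.

Lemma eventually_le_spread :
  (forall K : R, exists m (alpha t t' C : R),
     [/\ 0 < alpha, t + K < t', 0 <= C, alpha <= u m `[- C, t] & alpha <= u m `[t', C]]) ->
  forall K e : R, 0 <= K -> 0 < e -> eventually_le K e.
Proof.
move=> spread.
have inf_ge0 K : 0 <= inf (bounds K).
  apply: lb_le_inf; first by have [] := has_inf_bounds K.
  by move=> q [N /(_ N 0 (leqnn _))]; apply: le_trans; exact: visit_prob_ge0.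
have mono K q q' : q <= q' -> eventually_le K q -> eventually_le K q'.
  by move=> qq' [N h]; exists N => n x /h/le_trans; apply.
(* If doubling failed, the improved bound would lie below the infimum of all eventual bounds for
   windows of length K. *)
have doubling K : 0 <= K -> exists2 K', 0 <= K' & 2 * inf (bounds K) <= inf (bounds K').
  move=> K0; have [m [alpha [t [t' [C [a0 tt' C0 u1 u2]]]]]] := spread K.
  exists (K + C + C); first by lra.
  rewrite leNgt; apply/negP => lt2.
  have [q' bq' q'lt] : exists2 q', bounds (K + C + C) q' & q' < 2 * inf (bounds K).
    have d0 : 0 < 2 * inf (bounds K) - inf (bounds (K + C + C)) by lra.
    have [q' bq' q'lt] := inf_adherent d0 (has_inf_bounds (K + C + C)).
    by exists q' => //; lra.
  set lam := inf (bounds K) in lt2 q'lt *.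
  (* Half the gap between [lam] and [q' / 2], so that [q' < 2 * (lam - e)] still holds. *)
  have e0 : 0 < (lam - q' / 2) / 2 by lra.
  have hlam eta : 0 < eta -> eventually_le K (lam + eta).
    move=> eta0; have [q bq qlt] := inf_adherent eta0 (has_inf_bounds K).
    by apply: mono bq; exact: ltW.
  have ql : q' < 2 * (lam - (lam - q' / 2) / 2) by lra.
  have h := eventually_le_improve a0 K0 tt' u1 u2 bq' hlam e0 (inf_ge0 K) ql.
  have : lam <= lam - alpha * ((lam - q' / 2) / 2) / 2.
    by apply: ge_inf => //; have [] := has_inf_bounds K.
  have : 0 < alpha * ((lam - q' / 2) / 2) by exact: mulr_gt0.
  lra.
have inf_le1 K : inf (bounds K) <= 1.
  apply: ge_inf; first by have [] := has_inf_bounds K.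
  exists 0%N => n x _; apply: prob_le1; apply: measurableI.
    exact: measurable_state.
  exact: measurable_position_in.
(* Iterated doubling gives the factor [2 ^+ r]; the weaker factor r is enough to force the infimum
   to vanish. *)
have pow r K : 0 <= K -> r%:R * inf (bounds K) <= 1.
  move=> K0; apply: (@le_trans _ _ (2 ^+ r * inf (bounds K))).
    by rewrite ler_wpM2r// -natrX ler_nat ltnW// ltn_expl.
  elim: r K K0 => [|r IH] K K0; first by rewrite mul1r.
  have [K' K'0 KK'] := doubling K K0; apply: le_trans (IH K' K'0).
  by rewrite exprSr -mulrA ler_wpM2l// exprn_ge0.
move=> K e K0 e0.
have inf0 : inf (bounds K) <= 0.
  rewrite leNgt; apply/negP => i0'.
  have := pow (Num.truncn (inf (bounds K))^-1).+1 K K0; apply/negP; rewrite -ltNge.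
  by rewrite -ltr_pdivrMr// div1r truncnS_gt.
have [q bq qlt] := inf_adherent e0 (has_inf_bounds K).
by apply: mono bq; lra.
Qed.

End concentration.

(** * Recognizing a point mass *)

Section point_mass.
Context {R : realType} {d} {T : measurableType d} (P : probability T R).

(** The constant is the supremum of the levels below which [f] has no mass on [E]; slightly above it
    the lower tail is charged, hence the upper tail is null. *)
Lemma prob_point_mass (E : set T) (f : T -> R) :
  measurable E -> measurable_fun [set: T] f ->
  (forall t t', t < t' -> prob P (E `&` [set w | f w <= t]) = 0 \/
                          prob P (E `&` [set w | t' <= f w]) = 0) ->
  exists c, prob P (E `&` [set w | f w <> c]) = 0.
Proof.
move=> mE mf dich.
have ml t : measurable (E `&` [set w | f w <= t]).
  apply: measurableI => //; rewrite -[X in measurable X]setTI.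
  by rewrite -preimage_itvNyc; exact: mf.
have mg t : measurable (E `&` [set w | t <= f w]).
  apply: measurableI => //; rewrite -[X in measurable X]setTI.
  by rewrite -preimage_itvcy; exact: mf.
have mn t : measurable (E `&` [set w | f w <> t]).
  apply: measurableI => //; rewrite (_ : [set w | _] = f @^-1` (~` [set t]))//.
  rewrite -[X in measurable X]setTI; apply: mf => //; exact: measurableC.
pose D := [set t | prob P (E `&` [set w | f w <= t]) = 0].
have mono (A B : set T) : measurable A -> measurable B -> A `<=` B ->
    prob P B = 0 -> prob P A = 0.
  by move=> mA mB AB B0; apply/eqP; rewrite eq_le prob_ge0 andbT -B0; exact: le_prob.
have Ddown t t' : t <= t' -> D t' -> D t.
  move=> tt' Dt'; apply: mono Dt' => //.
  by move=> w [? /= h]; split => //=; exact: le_trans tt'.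
(* When [D] is empty or unbounded above, [E] itself is null and 0 serves as an arbitrary
   constant. *)
have [D0|D0] := pselect (D !=set0); last first.
  exists 0; apply: (mono _ (\bigcup_k (E `&` [set w | - k%:R <= f w]))) => //.
  - exact: bigcupT_measurable.
  - move=> w [Ew _]; exists (Num.truncn (- f w)).+1 => //; split => //=.
    by rewrite lerNl ltW// truncnS_gt.
  - apply: prob_bigcup_eq0 => // k.
    have [h|//] := dich (- k%:R - 1) (- k%:R) ltac:(lra).
    by exfalso; apply: D0; exists (- k%:R - 1).
have [Dub|Dub] := pselect (has_ubound D); last first.
  exists 0; apply: (mono _ (\bigcup_k (E `&` [set w | f w <= k%:R]))) => //.
  - exact: bigcupT_measurable.
  - move=> w [Ew _]; exists (Num.truncn (f w)).+1 => //; split => //=.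
    by rewrite ltW// truncnS_gt.
  - apply: prob_bigcup_eq0 => // k; have [h|h] := pselect (D k%:R); first exact: h.
    exfalso; apply: Dub; exists k%:R => t Dt; rewrite leNgt; apply/negP => /ltW kt.
    by apply: h; exact: Ddown Dt.
have sD : has_sup D by [].
exists (sup D).
pose F k := (E `&` [set w | f w <= sup D - k.+1%:R^-1]) `|`
            (E `&` [set w | sup D + k.+1%:R^-1 <= f w]).
have mF k : measurable (F k) by exact: measurableU.
apply: (mono _ (\bigcup_k F k)) => //; first exact: bigcupT_measurable.
  move=> w [Ew /eqP fw].
  have fw0 : 0 < `|f w - sup D| by rewrite normr_gt0 subr_eq0.
  pose k := Num.truncn `|f w - sup D|^-1.
  have kP : k.+1%:R^-1 <= `|f w - sup D|.
    by rewrite invf_ple ?posrE ?ltr0n// ltW// truncnS_gt.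
  exists k => //; move: kP; case: (ger0P (f w - sup D)) => _ kP.
    by right; split => //; rewrite /= -lerBrDl.
  by left; split => //; rewrite /= lerBrDr -lerBrDl -opprB.
apply: prob_bigcup_eq0 => // k; rewrite /F.
have k0 : 0 < k.+1%:R^-1 :> R by rewrite invr_gt0 ltr0n.
move: (k.+1%:R^-1) k0 => e k0.
have e1 : prob P (E `&` [set w | f w <= sup D - e]) = 0.
  have [t Dt tlt] := sup_adherent k0 sD.
  by apply: Ddown Dt; exact: ltW.
have e2 : prob P (E `&` [set w | sup D + e <= f w]) = 0.
  have [h|//] := dich (sup D + e / 2) (sup D + e) ltac:(lra).
  by have := ub_le_sup Dub h; lra.
apply/eqP; rewrite eq_le prob_ge0 andbT (le_trans (prob_leU _ (ml _) (mg _)))//.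
by rewrite e1 e2 addr0.
Qed.

End point_mass.

(** * Displacements between two states *)

Section travel.
Context {R : realType} {S : countType} {i0 : S}.
Local Notation T := (@trajectory R S i0).
Variables (L : S -> probability T R) (kappa : S -> S -> set R -> R).
Hypothesis LP : chain_law L kappa.

(** [visit_prob L i] is the case j = k = i up to conversion, so the lemmas on [travel] apply to it
    directly. *)
Definition travel j n k (A : set R) : R :=
  prob (L j) ([set w : T | state n w = k] `&` [set w : T | A (position n w)]).

Lemma measurable_travel n k A : measurable A ->
  measurable ([set w : T | state n w = k] `&` [set w : T | A (position n w)]).
Proof.
by move=> mA; apply: measurableI;
  [exact: measurable_state|exact: measurable_position_in].
Qed.

Lemma travel_ge0 j n k A : 0 <= travel j n k A.
Proof. exact: prob_ge0. Qed.

Lemma travel_mul_le j n k m l (A A' A'' : set R) :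
  measurable A -> measurable A' -> measurable A'' ->
  (forall x y, A x -> A' y -> A'' (x + y)) ->
  travel j n k A * travel k m l A' <= travel j (n + m) l A''.
Proof.
move=> mA mA' mA'' AA'.
have := markov LP j (n := n) k (measurable_position_in n mA)
  (@past_position_in _ _ _ n n A (leqnn n)) (measurable_travel m l mA').
rewrite (setIC _ [set w : T | state n w = k]) => <-; apply: le_prob.
- apply: measurableI; first exact: measurable_travel.
  exact: measurable_shift_preimage (measurable_travel m l mA').
- exact: measurable_travel.
- move=> w [[_ /= Aw] [/= sw Aw']]; split => //=.
  by rewrite position_shift; exact: AA'.
Qed.

Lemma travel0 j (A : set R) : measurable A -> A 0 -> travel j 0 j A = 1.
Proof.
move=> mA A0; rewrite /travel (_ : _ `&` _ = [set w : T | state 0 w = j]).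
  by rewrite /prob (chain_law_start LP).
by apply/seteqP; split => w; [case|move=> wj; split => //=; rewrite /position big_ord0].
Qed.

Lemma travel_bigcup_gt0 j n k (F : nat -> set R) :
  (forall r, measurable (F r)) -> 0 < travel j n k (\bigcup_r F r) ->
  exists r, 0 < travel j n k (F r).
Proof.
move=> mF; apply: contraPP => nF.
rewrite /travel (_ : _ `&` _ = \bigcup_r ([set w : T | state n w = k] `&`
    [set w | F r (position n w)])).
  rewrite prob_bigcup_eq0 ?ltxx//; first by move=> r; exact: measurable_travel.
  move=> r; apply/eqP; rewrite eq_le prob_ge0 andbT leNgt; apply/negP => h.
  by apply: nF; exists r.
by rewrite setI_bigcupr; apply/seteqP; split.
Qed.

Lemma travelD j n k A A' : measurable A -> measurable A' -> A `&` A' = set0 ->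
  travel j n k (A `|` A') = travel j n k A + travel j n k A'.
Proof.
move=> mA mA' AA'; rewrite /travel -probU; [|exact: measurable_travel|exact: measurable_travel|].
  by rewrite -setIUr.
apply/seteqP; split => // w [[_ Aw] [_ A'w]].
by have : (A `&` A') (position n w) by []; rewrite AA'.
Qed.

Lemma travel_mulr_gt0 j m r (A : set R) (A' : nat -> set R) : measurable A ->
  (forall r, measurable (A' r)) -> A' 0%N 0 ->
  (forall r x y, A' r x -> A y -> A' r.+1 (x + y)) ->
  0 < travel j m j A -> 0 < travel j (r * m) j (A' r).
Proof.
move=> mA mA' A0 AA' h; elim: r => [|r IH]; first by rewrite mul0n travel0.
rewrite mulSn addnC (lt_le_trans (mulr_gt0 IH h))//.
by apply: travel_mul_le => //; exact: AA'.
Qed.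

End travel.

(** * A potential from vanishing cycles *)

Section nontrivial_concentration.
Context {R : realType} {S : countType} {i0 : S}.
Local Notation T := (@trajectory R S i0).
Local Notation sh n := (@shift R S i0 n).
Variables (L : S -> probability T R) (kappa : S -> S -> set R -> R) (i : S).
Hypothesis LP : chain_law L kappa.
Hypothesis irreducible : forall j k, exists n, 0 < prob (L j) [set w : T | state n w = k].
Local Notation tr := (travel L).

Definition null_increments (g : S -> R) := forall n j,
  prob (L j) [set w : T | increment n w <> g (state n.+1 w) - g (state n w)] = 0.

Lemma travelT j n k : tr j n k setT = prob (L j) [set w : T | state n w = k].
Proof. by congr prob; apply/seteqP; split => w; [case|]. Qed.

Lemma travel_eq0 j n k A : travel L j n k A <= 0 -> tr j n k A = 0.
Proof. by move=> h; apply/eqP; rewrite eq_le h travel_ge0. Qed.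

Lemma measurable_neq (c : R) : measurable [set x : R | x <> c].
Proof. by rewrite (_ : [set x | _] = ~` [set c])//; exact: measurableC. Qed.

Lemma travel_point j n k (c : R) :
  tr j n k setT = tr j n k [set c] + tr j n k [set x | x <> c].
Proof.
rewrite -travelD//; [|exact: measurable_neq|by apply/seteqP; split => // x [/= ->]].
by congr (travel _ _ _ _ _); apply/seteqP; split => // x _; exact: lem.
Qed.

Lemma measurable_increment_neq (g : S -> R) n :
  measurable [set w : T | increment n w <> g (state n.+1 w) - g (state n w)].
Proof.
have mB k l : measurable [set w : T | increment n w <> g l - g k].
  rewrite -[X in measurable X]setTI.
  exact: (measurable_increment n measurableT (measurable_neq _)).
have mBk k := measurable_fibers (measurable_state n.+1) (mB k).
exact: (measurable_fibers (measurable_state n) mBk).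
Qed.

(* The position in state j is constant, since every path from i to j can be closed
   up to a cycle; this constant is the potential at j. *)
Lemma null_increments_of_cycles :
  (forall n, tr i n i [set x | x <> 0] = 0) -> exists g, null_increments g.
Proof.
move=> cyc.
have pm j : exists c, forall n, tr i n j [set x | x <> c] = 0.
  have [r hr] := irreducible j i; have [n hn] := irreducible i j.
  rewrite -!travelT in hr hn.
  (* A path from i to j followed by a path back is a cycle, whose displacement is almost surely 0.
     Hence two sets of displacements whose sums avoid 0 cannot both be charged. *)
  have orth n' (A A' : set R) : measurable A -> measurable A' ->
      (forall x y, A x -> A' y -> x + y <> 0) -> tr i n' j A = 0 \/ tr j r i A' = 0.
    move=> mA mA' AA'; have := travel_mul_le LP i n' j r i mA mA' (measurable_neq 0) AA'.
    rewrite cyc => h.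
    have /eqP : tr i n' j A * tr j r i A' = 0.
      by apply/eqP; rewrite eq_le h mulr_ge0// travel_ge0.
    by rewrite mulf_eq0 => /orP[/eqP|/eqP]; [left|right].
  have mle (t : R) : measurable [set x : R | x <= t].
    by rewrite -set_itvNyc; exact: measurable_itv.
  have mge (t : R) : measurable [set x : R | t <= x].
    by rewrite -set_itvcy; exact: measurable_itv.
  have mlt (t : R) : measurable [set x : R | x < t].
    by rewrite -set_itvNyo; exact: measurable_itv.
  have mgt (t : R) : measurable [set x : R | t < x].
    by rewrite -set_itvoy; exact: measurable_itv.
  have [c hc] : exists c, tr j r i [set x | x <> c] = 0.
    apply: (@prob_point_mass _ _ _ (L j) [set w : T | state r w = i] (position r)).
    - exact: measurable_state.
    - exact: measurable_position.
    - move=> t t' tt'.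
      (* If both tails of the displacement back to i were charged, the displacement to j would
         almost surely be at least [- t] and at most [- t'], impossible for t < t'. *)
      have o1 x y : x < - t -> y <= t -> x + y <> 0.
        by move=> ? ?; apply/eqP; rewrite lt_eqF//; lra.
      have o2 x y : - t' < x -> t' <= y -> x + y <> 0.
        by move=> ? ?; apply/eqP; rewrite gt_eqF//; lra.
      have [h1|h1] := orth n _ _ (mlt (- t)) (mle t) o1; last by left.
      have [h2|h2] := orth n _ _ (mgt (- t')) (mge t') o2; last by right.
      exfalso; move: hn; apply/negP; rewrite -leNgt.
      apply: (@le_trans _ _ (tr i n j [set x | x < - t] + tr i n j [set x | - t' < x])).
        rewrite (le_trans _ (prob_leU _ _ _))//; [|exact: measurable_travel|exact: measurable_travel].
        apply: le_prob; [exact: measurable_travel|by apply: measurableU; exact: measurable_travel|].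
        move=> w [wj _]; have [?|?] := ltP (position n w) (- t); first by left.
        by right; split => //=; lra.
      by rewrite h1 h2 addr0.
  exists (- c) => n'.
  have oc (x y : R) : x <> - c -> [set c] y -> x + y <> 0.
    by move=> xc /= ->; apply: contra_not xc => ?; lra.
  have [//|h0] := orth n' _ _ (measurable_neq (- c)) (measurable_set1 c) oc.
  by move: hr; rewrite (travel_point _ _ _ c) hc addr0 h0 ltxx.
have [g hg] := choice pm; exists g.
pose bad k l : set T := [set w : T | state 1 w = l] `&`
  [set w : T | increment 0 w <> g l - g k].
have minc n (c : R) : measurable [set w : T | increment n w <> c].
  rewrite -[X in measurable X]setTI.
  exact: (measurable_increment n measurableT (measurable_neq c)).
have mbad k l : measurable (bad k l).
  by apply: measurableI => //; exact: measurable_state.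
(* Reaching k with position [g k] and then making a wrong step to l would end in l at a position
   other than [g l], which has probability 0. *)
have bad0 k l : prob (L k) (bad k l) = 0.
  have [n hn] := irreducible i k; rewrite -travelT (travel_point _ _ _ (g k)) hg addr0 in hn.
  have := markov LP i (n := n) k (measurable_position_in n (measurable_set1 (g k)))
    (@past_position_in _ _ _ n n [set g k] (leqnn n)) (mbad k l).
  rewrite [X in X = _](_ : _ = 0); last first.
    apply/eqP; rewrite eq_le prob_ge0 andbT -(hg l n.+1); apply: le_prob.
    - apply: measurableI; last exact: measurable_shift_preimage.
      rewrite setIC; exact: measurable_travel.
    - by apply: measurable_travel; exact: measurable_neq.
    - move=> w [[/= wg wk] [/= wl winc]]; split => /=.
        by rewrite -wl state_shift addn1.
      rewrite /position big_ord_recr/= -/(position n w) wg.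
      apply: contra_not winc => <-.
      by rewrite /increment /shift addn0 addrAC subrr add0r.
  move/esym/eqP; rewrite mulf_eq0 => /orP[|/eqP//].
  by rewrite setIC => /eqP h0; move: hn; rewrite /travel h0 ltxx.
move=> n j.
have mA := measurable_increment_neq g n.
rewrite /prob (_ : L j _ = 0%E)//.
apply: (measure_fibers_eq0 (measurable_state n)) => // k.
apply: (measure_fibers_eq0 (measurable_state n.+1)) => //.
  by apply: measurableI => //; exact: measurable_state.
move=> l; apply/eqP; rewrite eq_le measure_ge0 andbT.
have := markov LP j (n := n) k measurableT (fun _ _ _ _ => I) (mbad k l).
rewrite bad0 mulr0 setTI => h0.
have msk : measurable ([set w : T | state n w = k] `&` sh n @^-1` bad k l).
  by apply: measurableI; [exact: measurable_state|exact: measurable_shift_preimage].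
apply: (@le_trans _ _ (L j ([set w : T | state n w = k] `&` sh n @^-1` bad k l))).
  2: by rewrite (probE _ msk) h0.
apply: le_measure; rewrite ?inE//.
  by apply: measurableI => //; [apply: measurableI => //|]; exact: measurable_state.
move=> w [[/= winc wk] wl]; split => //; split => /=; first by rewrite state_shift addn1.
by move: winc; rewrite wk wl /increment /shift addn0.
Qed.

End nontrivial_concentration.

(** * Spread against deterministic displacements *)

Section escape.
Context {R : realType} {S : countType} {i0 : S}.
Local Notation T := (@trajectory R S i0).
Variables (L : S -> probability T R) (kappa : S -> S -> set R -> R) (i : S).
Hypothesis LP : chain_law L kappa.
Hypothesis irreducible : forall j k, exists n, 0 < prob (L j) [set w : T | state n w = k].
Local Notation av := (@avoids R S i0 i).
Hypothesis recurrent : forall e : R, 0 < e ->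
  exists a0, forall a, (a0 <= a)%N -> prob (L i) (av 1 a) <= e.
Hypothesis nontriv : ~ exists g, null_increments L g.
Local Notation u := (visit_prob L i).

Let mle (t : R) : measurable [set x : R | x <= t].
Proof. by rewrite -set_itvNyc; exact: measurable_itv. Qed.
Let mge (t : R) : measurable [set x : R | t <= x].
Proof. by rewrite -set_itvcy; exact: measurable_itv. Qed.

(** Repeating the loop of length m r times stretches the gap from [t' - t] to [r * (t' - t)], which
    exceeds any given K. Both half-lines are then cut at a common level [C] without losing
    positivity. *)
Lemma position_escapes_spread m (t t' : R) : t < t' ->
  0 < u m [set x | x <= t] -> 0 < u m [set x | t' <= x] ->
  forall K e : R, 0 <= K -> 0 < e -> eventually_le L i K e.
Proof.
move=> tt' u1 u2; apply: (eventually_le_spread LP recurrent) => K.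
pose r := (Num.truncn (`|K| / (t' - t))).+1.
have rK : r%:R * t + K < r%:R * t'.
  have : `|K| / (t' - t) < r%:R by rewrite truncnS_gt.
  rewrite ltr_pdivrMr ?subr_gt0// => h; have := ler_norm K; rewrite mulrBr in h; lra.
have p1 : 0 < u (r * m) [set x | x <= r%:R * t].
  apply: (@travel_mulr_gt0 _ _ _ _ _ LP _ _ _
    ([set x | x <= t]) (fun r => [set x | x <= r%:R * t])) => //=; first by rewrite mul0r.
  by move=> k x y ? ?; rewrite -natr1 mulrDl mul1r lerD.
have p2 : 0 < u (r * m) [set x | r%:R * t' <= x].
  apply: (@travel_mulr_gt0 _ _ _ _ _ LP _ _ _
    ([set x | t' <= x]) (fun r => [set x | r%:R * t' <= x])) => //=; first by rewrite mul0r.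
  by move=> k x y ? ?; rewrite -natr1 mulrDl mul1r lerD.
have [C1 h1] : exists C1 : nat, 0 < u (r * m) `[- C1%:R, r%:R * t].
  apply: (@travel_bigcup_gt0 _ _ _ L i _ i (fun c => `[- c%:R, r%:R * t]%classic)).
    by move=> c; exact: measurable_itv.
  rewrite (_ : \bigcup_c _ = [set x | x <= r%:R * t])//.
  apply/seteqP; split => x; first by move=> [c _]; rewrite /= in_itv/= => /andP[].
  move=> /= xt; exists (Num.truncn (- x)).+1 => //=; rewrite in_itv/= xt andbT.
  by rewrite lerNl ltW// truncnS_gt.
have [C2 h2] : exists C2 : nat, 0 < u (r * m) `[r%:R * t', C2%:R].
  apply: (@travel_bigcup_gt0 _ _ _ L i _ i (fun c => `[r%:R * t', c%:R]%classic)).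
    by move=> c; exact: measurable_itv.
  rewrite (_ : \bigcup_c _ = [set x | r%:R * t' <= x])//.
  apply/seteqP; split => x; first by move=> [c _]; rewrite /= in_itv/= => /andP[].
  move=> /= xt; exists (Num.truncn x).+1 => //=; rewrite in_itv/= xt/=.
  by rewrite ltW// truncnS_gt.
pose C : R := (C1 + C2)%:R.
have C1C : C1%:R <= C by rewrite ler_nat leq_addr.
have C2C : C2%:R <= C by rewrite ler_nat leq_addl.
have h1' : 0 < u (r * m) `[- C, r%:R * t].
  apply: (lt_le_trans h1); apply: le_visit_prob => //.
  by move=> x /=; rewrite !in_itv/= => /andP[? ->]; rewrite andbT; lra.
have h2' : 0 < u (r * m) `[r%:R * t', C].
  apply: (lt_le_trans h2); apply: le_visit_prob => //.
  by move=> x /=; rewrite !in_itv/= => /andP[-> ?]; lra.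
exists (r * m)%N, (Num.min (u (r * m) `[- C, r%:R * t]) (u (r * m) `[r%:R * t', C])).
exists (r%:R * t), (r%:R * t'), C; split => //.
- by rewrite lt_min h1' h2'.
- by rewrite ge_min lexx.
- by rewrite ge_min lexx orbT.
Qed.

(** If visits at times n and n0 both have positive probability, computing the position at time n0 *
    n by repeating either loop gives [n0 * h n = n * h n0]. So [h] grows linearly along such times
    once [h n0] is nonzero, and at other times there is no mass at all. *)
Lemma position_escapes_linear (h : nat -> R) :
  (forall n, u n [set x | x <> h n] = 0) ->
  forall K : R, exists N, forall n, (N <= n)%N -> u n `[- K, K] = 0.
Proof.
move=> uh K.
have uhT n : 0 < u n setT -> 0 < u n [set h n].
  by have := travel_point L i n i (h n); rewrite [travel _ _ _ _ [set _ | _ <> _]]uh addr0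
    => e; rewrite {1}[u n setT]e.
have mul_h n r : 0 < u n setT -> h (r * n)%N = r%:R * h n.
  move=> /uhT hn; have : 0 < u (r * n) [set r%:R * h n].
    apply: (@travel_mulr_gt0 _ _ _ _ _ LP _ _ _
    ([set h n]) (fun r => [set r%:R * h n])) => //=.
      by rewrite mul0r.
    by move=> k x y -> ->; rewrite -natr1 mulrDl mul1r.
  apply: contraPP => hr; rewrite (_ : u _ _ = 0) ?ltxx//.
  apply/eqP; rewrite eq_le visit_prob_ge0 andbT -(uh (r * n)%N).
  apply: le_visit_prob => //; first exact: measurable_neq.
  by move=> x /= -> /esym.
have [n0 un0] : exists n0, 0 < u n0 [set x | x <> 0].
  apply: contrapT => nex; apply: nontriv; apply: (null_increments_of_cycles LP irreducible (i := i)).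
  by move=> n; apply/travel_eq0; rewrite leNgt; apply/negP => ?; apply: nex; exists n.
have hn0 : h n0 != 0.
  by apply/eqP => h0; have := uh n0; rewrite h0 => un00; rewrite un00 ltxx in un0.
have uT : 0 < u n0 setT.
  by apply: (lt_le_trans un0); apply: le_visit_prob => //; exact: measurable_neq.
have n0p : 0 < n0%:R :> R.
  rewrite ltr0n lt0n; apply: contra hn0 => /eqP n00.
  by have := mul_h n0 0 uT; rewrite n00 mul0n mul0r => ->.
exists (Num.truncn (n0%:R * `|K| / `|h n0|)).+1 => n nN.
apply/eqP; rewrite eq_le visit_prob_ge0 andbT leNgt; apply/negP => un.
have unT : 0 < u n setT by apply: (lt_le_trans un); exact: le_visit_prob.
have e : n0%:R * h n = n%:R * h n0 by rewrite -!mul_h// mulnC.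
have big : `|K| < `|h n|.
  rewrite -(ltr_pM2l n0p) -[X in _ < X * _](ger0_norm (ltW n0p)) -normrM e normrM.
  rewrite ger0_norm// -ltr_pdivrMr ?normr_gt0//.
  by rewrite (lt_le_trans (truncnS_gt _))// ler_nat.
move: un; apply/negP; rewrite -leNgt -(uh n); apply: le_visit_prob => //.
  exact: measurable_neq.
move=> x /=; rewrite in_itv/= -ler_norml => xK xh.
by move: big; rewrite -xh ltNge (le_trans xK)// ler_norm.
Qed.

Lemma position_escapes (K e : R) : 0 < e ->
  exists N, forall n, (N <= n)%N -> u n `[- K, K] <= e.
Proof.
move=> e0; have [sp|nsp] := pselect (exists m t t', [/\ t < t',
    0 < u m [set x | x <= t] & 0 < u m [set x | t' <= x]]).
  have [m [t [t' [tt' u1 u2]]]] := sp.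
  have K0 : 0 <= `|K| + `|K| by rewrite addr_ge0.
  have [N hN] := position_escapes_spread tt' u1 u2 K0 e0.
  exists N => n /(hN _ (- `|K|)); apply: le_trans; apply: le_visit_prob => //.
  move=> x /=; rewrite !in_itv/= => /andP[? ?]; have := ler_norm K => ?.
  by apply/andP; split; lra.
have pm n : exists c, u n [set x | x <> c] = 0.
  apply: (@prob_point_mass _ _ _ (L i) [set w : T | state n w = i] (position n)).
  - exact: measurable_state.
  - exact: measurable_position.
  - move=> t t' tt'; apply: contrapT => /not_orP[/eqP h1 /eqP h2]; apply: nsp.
    by exists n, t, t'; split => //; rewrite lt0r visit_prob_ge0 andbT.
have [h hh] := choice pm.
have [N hN] := position_escapes_linear hh K.
by exists N => n /hN ->; exact: ltW.
Qed.

End escape.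

(** * Cycle reversal *)

Section reversal.
Context {R : realType} {S : countType} {i0 : S}.
Local Notation T := (@trajectory R S i0).
Local Notation av := (@avoids R S i0).

(** The increment of index k belongs to the step from k to k + 1, hence the shift to [n.-1 - k].
    Coordinates beyond the first n steps are artefacts of truncated subtraction; probabilities are
    compared for events of [past n] only. *)
Definition reverse n (w : T) : T := fun k =>
  (state (n - k) w, increment (n.-1 - k) w).

Lemma measurable_reverse n : measurable_fun [set: T] (reverse n).
Proof.
apply: measurable_into_trajectory => [k j|k].
  exact: (measurable_state (n - k) j).
exact: (measurable_increment (n.-1 - k)).
Qed.

Lemma position_reverse n w : position n (reverse n w) = position n w.
Proof.
rewrite /position (reindex_inj rev_ord_inj)/=; apply: eq_bigr => k _.
rewrite /increment/=; congr (w _).2; have := ltn_ord k; lia.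
Qed.

Lemma avoids_reverse i n w : av i 1 n (reverse n.+1 w) <-> av i 1 n w.
Proof.
split => h k kn; last by apply: (h (n.+1 - k)%N); lia.
have := h (n.+1 - k)%N; rewrite /state/= subKn; last by lia.
by apply; lia.
Qed.

Variables (L : S -> probability T R) (kappa : S -> S -> set R -> R).
Variables (L' : S -> probability T R) (kappa' : S -> S -> set R -> R).
Hypothesis LP : chain_law L kappa.
Hypothesis LP' : chain_law L' kappa'.
Variable pi_ : S -> R.
Hypothesis pi_neq0 : forall j, pi_ j != 0.
Hypothesis dual : forall j k A, kappa' j k A = pi_ k * kappa k j A / pi_ j.

Lemma prod_dual n (s : nat -> S) (A : nat -> set R) :
  \prod_(k < n) kappa' (s k) (s k.+1) (A k) =
  pi_ (s n) / pi_ (s 0%N) * \prod_(k < n) kappa (s k.+1) (s k) (A k).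
Proof.
elim: n => [|n IH]; first by rewrite !big_ord0 mulr1 divff.
rewrite !big_ord_recr/= IH dual; have := pi_neq0 (s n); have := pi_neq0 (s 0%N).
by move: (pi_ _) (pi_ _) (pi_ _) => a b c b0 c0; field; rewrite b0 c0.
Qed.

Lemma prob_reverse i n (B : set T) : measurable B -> past n B ->
  prob (L i) ([set w : T | state n w = i] `&` reverse n @^-1` B) =
  prob (L' i) ([set w : T | state n w = i] `&` B).
Proof.
move=> mB pB; rewrite /prob; congr fine.
have mS := @measurable_state R S i0 n i.
have mr := measurable_reverse n.
rewrite setIC [in RHS]setIC.
suff : pushforward (mrestr (L i) mS) (reverse n) B = mrestr (L' i) mS B by exact.
apply: (@eq_measure_stopped _ _ _ n) => //.
  change (L i (reverse n @^-1` setT `&` [set w : T | state n w = i]) < +oo)%E.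
  by rewrite preimage_setT setTI ltey_eq fin_num_measure.
move=> s A mA.
change (L i (reverse n @^-1` cylinder n s A `&` [set w : T | state n w = i]) =
  L' i (cylinder n s A `&` [set w : T | state n w = i])).
have cylE : reverse n @^-1` cylinder n s A =
    cylinder n (fun k => s (n - k)%N) (fun k => A (n.-1 - k)%N) :> set T.
  apply/seteqP; split => w [h1 h2]; split => k kn.
  - by have := h1 (n - k)%N (leq_subr _ _); rewrite /= subKn.
  - have := h2 (n.-1 - k)%N; rewrite /= /increment subKn; last by lia.
    by apply; lia.
  - by have := h1 (n - k)%N (leq_subr _ _); rewrite /= subKn.
  - have := h2 (n.-1 - k)%N; rewrite /= /increment subKn; last by lia.
    by apply; lia.
have mA' : measurable_family (fun k => A (n.-1 - k)%N) by move=> k.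
have [sn|sn] := eqVneq (s n) i; last first.
  rewrite [in RHS](_ : _ `&` _ = set0); last first.
    apply/seteqP; split => // w [[h _] wn]; move/eqP: sn; apply.
    by rewrite -h// -wn.
  rewrite measure0; apply/eqP; rewrite eq_le measure_ge0 andbT.
  (* The reversed cylinder starts at [s n], which differs from i, so [L i] does not charge it. *)
  have := LP i n (fun k => s (n - k)%N) mA'; rewrite subn0 (negbTE sn) mul0r -cylE => e.
  apply: (@le_trans _ _ (L i (reverse n @^-1` cylinder n s A))); last by rewrite e.
  apply: le_measure; rewrite ?inE//; last by rewrite cylE; exact: measurable_cylinder.
  by apply: measurableI => //; rewrite cylE; exact: measurable_cylinder.
rewrite (_ : cylinder n s A `&` _ = cylinder n s A); last first.
  by apply/seteqP; split => w [] // h1 h2; split => //=; rewrite -sn; exact: h1.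
rewrite LP'//; have [s0|s0] := eqVneq (s 0%N) i; last first.
  rewrite mul0r (_ : _ `&` _ = set0) ?measure0//.
  apply/seteqP; split => // w [[h _] wn]; move/eqP: s0; apply.
  by rewrite -h// -[RHS]wn /= subn0.
rewrite cylE (_ : _ `&` _ = cylinder n (fun k => s (n - k)%N) (fun k => A (n.-1 - k)%N)); last first.
  apply/seteqP; split => w [] // h1 h2; split => //=.
  by have := h1 n (leqnn _); rewrite subnn s0.
rewrite LP// subn0 sn eqxx prod_dual s0 sn divff// !mul1r; congr _%:E.
rewrite (reindex_inj rev_ord_inj)/=; apply: eq_bigr => k _.
by have := ltn_ord k => kn; congr (kappa (s _) (s _) (A _)); lia.
Qed.

(** For a single time the whole path can be reversed at once, since its total displacement does not
    depend on the order of the steps. This hands the escape to infinity over to the dual. *)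
Lemma visit_prob_dual i n (A : set R) : measurable A ->
  visit_prob L i n A = visit_prob L' i n A.
Proof.
move=> mA; rewrite /visit_prob -prob_reverse; last 2 first.
- exact: measurable_position_in.
- exact: past_position_in.
congr (prob _ (_ `&` _)).
by apply/seteqP; split => w /=; rewrite position_reverse.
Qed.

Definition first_return_prob (Q : S -> probability T R) i n (A : set R) :=
  prob (Q i) (av i 1 n `&` [set w : T | state n.+1 w = i] `&`
              [set w : T | A (position n.+1 w)]).

Lemma first_return_prob_dual i n (A : set R) : measurable A ->
  first_return_prob L i n A = first_return_prob L' i n A.
Proof.
move=> mA; rewrite /first_return_prob (setIC (av i 1 n)) -!setIA -prob_reverse.
- congr (prob _ (_ `&` _)); apply/seteqP; split => w /= [h1 h2].
    by rewrite position_reverse; split => //; apply/avoids_reverse.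
  by rewrite position_reverse in h2; split => //; apply/avoids_reverse.
- by apply: measurableI; [exact: measurable_avoids|exact: measurable_position_in].
- by apply: pastI; [exact: past_le (leqnSn n) (@past_avoids _ _ _ i 1 n)|exact: past_position_in].
Qed.

(** An unfinished cycle cannot be reversed, but its probability is what first returns up to time n
    leave over, and these are events on completed cycles. *)
Lemma prob_avoids_dual i n : prob (L i) (av i 1 n) = prob (L' i) (av i 1 n).
Proof.
elim: n => [|n IH].
  have -> : av i 1 0 = setT by apply/seteqP; split => // w _ k; lia.
  by rewrite !probT.
have mn := measurable_avoids (R := R) (i0 := i0) i 1 n.
have mS := @measurable_state R S i0 n.+1 i.
have e Q : prob (Q i) (av i 1 n.+1) = prob (Q i) (av i 1 n) - first_return_prob Q i n setT.
  rewrite (probDI (Q i) mn mS) avoidsS// /first_return_prob.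
  rewrite [X in _ = _ + prob _ _ - prob _ X](_ : _ = av i 1 n `&` [set w : T | state n.+1 w = i]).
    by rewrite addrK.
  by apply/seteqP; split => w; [case|].
by rewrite !e IH first_return_prob_dual.
Qed.

End reversal.

(** * The walk observed only at its returns *)

Section embedded_walk.
Context {R : realType} {S : countType} {i0 : S} (i : S).
Local Notation T := (@trajectory R S i0).
Local Notation T2 := (@trajectory R bool true).
Local Notation av := (@avoids R S i0 i).
Local Notation sh n := (@shift R S i0 n).

(* V_n, taken to be 0 before the first visit to i. *)
Fixpoint anchor n (w : T) : R :=
  if n is m.+1 then if state n w == i then position n w else anchor m w else 0.

Lemma anchor_visit n w : state n w = i -> anchor n w = position n w.
Proof. by case: n => [|n] /= wi; rewrite ?wi ?eqxx// /position big_ord0. Qed.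

Lemma anchorS_avoid n w : state n.+1 w <> i -> anchor n.+1 w = anchor n w.
Proof. by move=> /eqP/negbTE /= ->. Qed.

Lemma anchor_avoids n m w : (n <= m)%N -> av n.+1 m w -> anchor m w = anchor n w.
Proof.
move=> /subnK <-; elim: (m - n)%N => // k IH h.
rewrite addSn anchorS_avoid; last by apply: h; lia.
by apply: IH => l l1; apply: h; lia.
Qed.

Lemma agree_anchor n w w' : agree n w w' -> anchor n w = anchor n w'.
Proof.
elim: n => //= n IH ww'; rewrite (agree_position ww') IH; last exact: agree_le ww'.
by have [h _] := ww'; rewrite h.
Qed.

Lemma measurable_anchor n : measurable_fun [set: T] (anchor n).
Proof.
elim: n => [|n IH] /=; first exact: measurable_cst.
apply: measurable_fun_ifT => //; last exact: measurable_position.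
apply: (measurable_fun_bool true); rewrite setTI.
rewrite (_ : _ @^-1` _ = [set w : T | state n.+1 w = i]).
  exact: measurable_state.
by apply/seteqP; split => w /= /eqP.
Qed.

(* Forgets what happens inside the cycles: a walk driven by a chain on bool. *)
Definition embed (w : T) : T2 := fun k =>
  (state k w == i, anchor k.+1 w - anchor k w).

Arguments anchor : simpl never.

Lemma position_embed n w : position n (embed w) = anchor n w.
Proof.
elim: n => [|n IH]; first by rewrite /position big_ord0.
by rewrite /position big_ord_recr/= -/(position n _) IH /increment /= addrC subrK.
Qed.

Lemma measurable_embed : measurable_fun [set: T] embed.
Proof.
apply: measurable_into_trajectory => [k b|k].
  have mk := @measurable_state R S i0 k i.
  case: b; [rewrite (_ : [set u | _] = [set w : T | state k w = i])//|
            rewrite (_ : [set u | _] = ~` [set w : T | state k w = i])].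
  - by apply/seteqP; split => w /= /eqP.
  - exact: measurableC.
  - by apply/seteqP; split => w /=; rewrite /state/=; case: eqP.
by apply: measurable_funB; exact: measurable_anchor.
Qed.

Lemma past_embed n (B : set T2) : past n B -> past n (embed @^-1` B).
Proof.
move=> pB w w' ww'; apply: pB; split => k kn.
  by rewrite /state/=; have [h _] := ww'; congr (_ == _); exact: h.
rewrite /increment/= (agree_anchor (agree_le _ ww'))//.
by rewrite (agree_anchor (agree_le _ ww'))// ltnW.
Qed.

Lemma past_embed_cylinder n s A : past n (embed @^-1` cylinder n s A).
Proof. by apply: past_embed; exact: past_cylinder. Qed.

Lemma measurable_embed_cylinder n s A : measurable_family A ->
  measurable (embed @^-1` cylinder n s A).
Proof.
move=> mA; rewrite -[X in measurable X]setTI; apply: measurable_embed => //.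
exact: measurable_cylinder.
Qed.

(* [b] tells whether the cycle is completed at time m.+1 or still running then. *)
Definition last_cycle m (b : bool) (A : set R) : set T :=
  if b then av 1 m `&` [set w : T | state m.+1 w = i] `&`
            [set w : T | A (position m.+1 w)]
  else av 1 m.+1.

Lemma measurable_last_cycle m b A : measurable A -> measurable (last_cycle m b A).
Proof.
move=> mA; rewrite /last_cycle; case: b; last exact: measurable_avoids.
apply: measurableI; last exact: measurable_position_in.
by apply: measurableI; [exact: measurable_avoids|exact: measurable_state].
Qed.

(** Here l is the last prescribed visit before the final time. Until the next visit the anchor
    stands still, so the constraints after l reduce to 0 belonging to [A k]; only a visit at the
    final time tests the displacement over the last cycle against [A (l + m)]. *)
Lemma embed_cylinder_split l m (s : nat -> bool) (A : nat -> set R) : s l ->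
  (forall k, (l < k < (l + m).+1)%N -> ~~ s k) ->
  (forall k, (l <= k <= l + m)%N -> ~~ s k.+1 -> A k 0) ->
  embed @^-1` cylinder (l + m).+1 s A =
  embed @^-1` cylinder l s A `&` [set w : T | state l w = i] `&`
  sh l @^-1` last_cycle m (s (l + m).+1) (A (l + m)%N).
Proof.
move=> sl snk A0; apply/seteqP; split => w.
  move=> [h1 h2].
  have wl : state l w = i by have := h1 l; rewrite sl /= => h; apply/eqP; apply: h; lia.
  have wa : av l.+1 (l + m) w.
    move=> k kn; have := snk k kn; rewrite -h1; last by lia.
    by move=> /= /eqP.
  split; first split => //; first by split => k kn; [apply: h1|apply: h2]; lia.
  have ha : (sh l @^-1` av 1 m) w by apply/shift_avoids; rewrite addn1.
  have wS := h1 (l + m).+1 (leqnn _).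
  rewrite /last_cycle; case es : (s (l + m).+1) in wS *.
    have wi : state (l + m).+1 w = i by apply/eqP; exact: wS.
    split; first by split => //=; rewrite state_shift addnS.
    have := h2 (l + m)%N (leqnn _); rewrite /= (anchor_visit wi).
    rewrite (anchor_avoids (leq_addr m l) wa) (anchor_visit wl).
    by rewrite -addnS position_shift addrAC subrr add0r.
  have wi : state (l + m).+1 w <> i by apply/eqP/negbT; exact: wS.
  apply/shift_avoids => k /andP[k1]; rewrite leq_eqVlt addnS => /orP[/eqP ->//|kn].
  by apply: wa; lia.
move=> [[[h1 h2] wl] hl].
have ha : av l.+1 (l + m) w.
  rewrite -[l.+1]addn1; apply/shift_avoids; move: hl; rewrite /last_cycle.
  case: (s _) => [[[]]//|h k kn]; apply: h; lia.
have hS : (state (l + m).+1 w == i) = s (l + m).+1.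
  move: hl; rewrite /last_cycle; case: (s _) => [[[_ /= h] _]|h].
    by rewrite -addnS -state_shift; apply/eqP.
  by apply/negbTE/eqP; rewrite -addnS -state_shift; apply: h; lia.
split => k kn.
  have [kl|lk] := leqP k l; first exact: h1.
  have [->|kne] := eqVneq k (l + m).+1; first exact: hS.
  have kn' : (l < k < (l + m).+1)%N by lia.
  by rewrite (negbTE (snk k kn')) /=; apply/negbTE/eqP; apply: ha.
have [kl|lk] := ltnP k l; first exact: h2.
have sE : (state k.+1 w == i) = s k.+1.
  have [->//|kne] := eqVneq k (l + m)%N.
  have kn' : (l < k.+1 < (l + m).+1)%N by lia.
  by rewrite (negbTE (snk _ kn')); apply/negbTE/eqP; apply: ha.
have [sk|sk] := boolP (s k.+1); last first.
  have nw : state k.+1 w <> i by apply/eqP; rewrite sE.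
  by rewrite /= (anchorS_avoid nw) subrr; apply: A0 => //; lia.
have ke : k = (l + m)%N.
  by apply/eqP; apply: contraTT sk => kne; apply: snk; lia.
have wk : state k.+1 w = i by apply/eqP; rewrite sE.
subst k; move: hl; rewrite sk => -[_ /=].
rewrite (anchor_visit wk) (anchor_avoids (leq_addr m l) ha) (anchor_visit wl).
by rewrite -addnS position_shift addrAC subrr add0r.
Qed.

Lemma embed_cylinder_eq0 l m (s : nat -> bool) (A : nat -> set R) : s l ->
  (forall k, (l < k < (l + m).+1)%N -> ~~ s k) ->
  ~ (forall k, (l <= k <= l + m)%N -> ~~ s k.+1 -> A k 0) ->
  embed @^-1` cylinder (l + m).+1 s A = set0.
Proof.
move=> sl snk nA0; apply/seteqP; split => // w [h1 h2]; apply: nA0 => k kn sk.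
have nw : state k.+1 w <> i.
  apply/eqP; have := h1 k.+1; rewrite /= -/(state k.+1 w) => -> //; lia.
have := h2 k; rewrite /= (anchorS_avoid nw) subrr; apply; lia.
Qed.

End embedded_walk.

(** * Equality in law of the two embedded walks *)

Section embedded_law.
Context {R : realType} {S : countType} {i0 : S} (i : S).
Local Notation T := (@trajectory R S i0).
Local Notation T2 := (@trajectory R bool true).
Local Notation av := (@avoids R S i0 i).
Variables (L : S -> probability T R) (kappa : S -> S -> set R -> R).
Variables (L' : S -> probability T R) (kappa' : S -> S -> set R -> R).
Hypothesis LP : chain_law L kappa.
Hypothesis LP' : chain_law L' kappa'.
Hypothesis return_law : forall n A, measurable A ->
  first_return_prob L i n A = first_return_prob L' i n A.
Hypothesis avoids_law : forall n, prob (L i) (av 1 n) = prob (L' i) (av 1 n).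

Let E n s A : set T := embed i @^-1` cylinder n s A.

Let embed_cylinder0 (Q : S -> probability T R) k0 s A : chain_law Q k0 ->
  prob (Q i) (E 0 s A) = (s 0%N)%:R.
Proof.
move=> QP; have mS := @measurable_state R S i0 0 i.
have P0 : prob (Q i) [set w : T | state 0 w = i] = 1.
  by rewrite /prob (chain_law_start QP).
have [s0|s0] := boolP (s 0%N).
  rewrite (_ : E 0 s A = [set w : T | state 0 w = i])//.
  apply/seteqP; split => w; first by move=> [/(_ 0%N (leqnn _)) /= + _]; rewrite s0 => /eqP.
  by move=> /= wi; split => // k; rewrite leqn0 => /eqP ->; rewrite s0 /=; apply/eqP.
rewrite (_ : E 0 s A = ~` [set w : T | state 0 w = i]).
  by rewrite probC// P0 subrr.
apply/seteqP; split => w.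
  by move=> [/(_ 0%N (leqnn _)) /= + _]; rewrite (negbTE s0) => /eqP.
move=> /= wi; split => // k; rewrite leqn0 => /eqP ->.
by rewrite (negbTE s0) /=; apply/negbTE/eqP.
Qed.

(** The Markov property at the last prescribed visit splits off one factor, a first-return or an
    avoidance probability, on which both walks agree. What is left is a cylinder shorter by an
    arbitrary amount, hence the strong induction. *)
Let embed_cylinder_law n s A : measurable_family A ->
  prob (L i) (E n s A) = prob (L' i) (E n s A).
Proof.
move=> mA; have [N] := ubnP n; elim: N n => // N IH [|n] nN.
  by rewrite (embed_cylinder0 _ _ LP) (embed_cylinder0 _ _ LP').
have [s0|s0] := boolP (s 0%N); last first.
  have z (Q : S -> probability T R) k0 : chain_law Q k0 -> prob (Q i) (E n.+1 s A) = 0.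
    move=> QP; apply/eqP; rewrite eq_le prob_ge0 andbT.
    have := embed_cylinder0 s A QP; rewrite (negbTE s0) => E0.
    apply: (@le_trans _ _ (prob (Q i) (E 0 s A))); last by rewrite E0.
    apply: le_prob.
    - exact: measurable_embed_cylinder.
    - exact: measurable_embed_cylinder.
    - by move=> w [h _]; split => // k; rewrite leqn0 => /eqP ->; exact: h.
  by rewrite (z _ _ LP) (z _ _ LP').
have [l [ln sl snk]] : exists l, [/\ (l <= n)%N, s l &
    forall k, (l < k < n.+1)%N -> ~~ s k].
  have ex : exists k, (k <= n)%N && s k by exists 0%N.
  have ub k : (k <= n)%N && s k -> (k <= n)%N by move=> /andP[].
  case: (ex_maxnP ex ub) => l /andP[ln sl] mx; exists l; split => // k /andP[lk kn].
  by apply/negP => sk; have := mx k; rewrite sk -ltnS kn => /(_ isT); rewrite leqNgt lk.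
rewrite -(subnKC ln) in snk *; set m := (n - l)%N in snk *.
have [C|C] := pselect (forall k, (l <= k <= l + m)%N -> ~~ s k.+1 -> A k 0); last first.
  by rewrite /E embed_cylinder_eq0// !prob0.
rewrite /E embed_cylinder_split//.
have mE := measurable_embed_cylinder (i0 := i0) i l s mA.
have pE := @past_embed_cylinder R S i0 i l s A.
have mc := measurable_last_cycle (i0 := i0) i m (s (l + m).+1) (mA (l + m)%N).
rewrite (markov LP)// (markov LP')//.
have -> : embed i @^-1` cylinder l s A `&` [set w : T | state l w = i] = E l s A.
  apply/seteqP; split => w [] // h1 h2; split => //=; apply/eqP.
  by have := h1 l (leqnn _); rewrite /= sl.
rewrite IH; last by lia.
congr (_ * _); rewrite /last_cycle; case: (s _); last exact: avoids_law.
exact: return_law.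
Qed.

Lemma embed_law (B : set T2) : measurable B ->
  L i ((embed i : T -> T2) @^-1` B) = L' i ((embed i : T -> T2) @^-1` B).
Proof.
move=> mB; have me := @measurable_embed R S i0 i.
suff : forall B, measurable B ->
  pushforward (L i) (embed i : T -> T2) B = pushforward (L' i) (embed i : T -> T2) B by move=> /(_ B mB).
apply: (@eq_measure_cylinders _ _ _ 0) => //.
  change (L i ((embed i : T -> T2) @^-1` setT) < +oo)%E.
  by rewrite preimage_setT ltey_eq fin_num_measure.
move=> n s A _ mA.
change (L i (E n s A) = L' i (E n s A)).
have mE : measurable (E n s A) by exact: measurable_embed_cylinder.
by rewrite !probE// embed_cylinder_law.
Qed.

End embedded_law.

(** * Signs of the walk and of its last return position *)

Lemma bounded_sum_tail (R : realType) (f : nat -> R) (C e : R) :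
  (forall n, 0 <= f n) -> (forall n, \sum_(k < n) f k <= C) -> 0 < e ->
  exists N, forall m, \sum_(k < m) f (N + k)%N <= e.
Proof.
move=> f0 fC e0; pose D := range (fun n => \sum_(k < n) f k).
have sD : has_sup D.
  split; first by exists (\sum_(k < 0) f k), 0%N.
  by exists C => _ [n _ <-].
have [_ [N _ <-] hN] := sup_adherent e0 sD.
exists N => m; have : \sum_(k < N + m) f k <= sup D.
  by apply: ub_le_sup; [case: sD|exists (N + m)%N].
by rewrite big_split_ord/=; move: hN; lra.
Qed.

Section sign_of_anchor.
Context {R : realType} {S : countType} {i0 : S}.
Local Notation T := (@trajectory R S i0).
Local Notation sh n := (@shift R S i0 n).
Local Notation av := (@avoids R S i0).
Variables (L : S -> probability T R) (kappa : S -> S -> set R -> R) (i : S).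
Hypothesis LP : chain_law L kappa.
Variable C : R.
Hypothesis summable : forall n, \sum_(a < n) prob (L i) (av i 1 a) <= C.
Local Notation P := (prob (L i)).

Lemma avoids_recurrent e : 0 < e ->
  exists a0, forall a, (a0 <= a)%N -> P (av i 1 a) <= e.
Proof.
move=> e0; have [N hN] := bounded_sum_tail (f := fun a => P (av i 1 a)) (fun n => prob_ge0 _ _) summable e0.
exists N => a Na; have := hN (a - N).+1; rewrite big_ord_recr/= subnKC//.
by apply: le_trans; rewrite lerDr sumr_ge0// => k _; exact: prob_ge0.
Qed.

Lemma measurable_far K n : measurable [set w : T | K < `|position n w|].
Proof.
have mf : measurable_fun [set: T] (fun w => `|position n w|).
  by apply: measurableT_comp => //; exact: measurable_position.
by rewrite -[X in measurable X]setTI -preimage_itvoy; apply: mf.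
Qed.

(** Finitely many times are concerned, so continuity from above for each of them yields a common
    [K]. *)
Lemma position_tight A e : 0 < e ->
  exists K : R, forall a, (a <= A)%N -> P [set w : T | K < `|position a w|] <= e.
Proof.
move=> e0.
have one a : exists K : nat, P [set w : T | K%:R < `|position a w|] <= e.
  have mF (k : nat) := measurable_far k%:R a.
  have cF : prob (L i) [set w : T | (k%:R : R) < `|position a w|] @[k --> \oo] --> (0 : R).
    apply: (@prob_nonincreasing_cvg0 _ _ _ (L i)
      (fun k => [set w : T | (k%:R : R) < `|position a w|])) => //.
      by move=> k w /=; apply: le_lt_trans; rewrite ler_nat.
    rewrite (_ : \bigcap_k _ = set0) ?measure0//; apply/seteqP; split => // w.
    move=> /(_ (Num.truncn `|position a w|).+1 Logic.I) /=.
    by rewrite ltNge ltW// truncnS_gt.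
  have /cvgrPdist_le /(_ _ e0) [K _ hK] := cF.
  by exists K; have := hK K (leqnn K); rewrite sub0r normrN ger0_norm ?prob_ge0.
elim: A => [|A [K hK]].
  by have [K hK] := one 0%N; exists K%:R => a; rewrite leqn0 => /eqP ->.
have [K' hK'] := one A.+1.
have far (k k' : R) a : k <= k' -> P [set w : T | k' < `|position a w|] <= P [set w : T | k < `|position a w|].
  move=> kk'; apply: le_prob; [exact: measurable_far|exact: measurable_far|].
  by move=> w; exact: le_lt_trans.
exists (Num.max K K'%:R) => a; rewrite leq_eqVlt => /orP[/eqP ->|aA].
  by apply: le_trans hK'; apply: far; rewrite le_max lexx orbT.
by apply: le_trans (hK a aA); apply: far; rewrite le_max lexx.
Qed.

Hypothesis escapes : forall K e : R, 0 < e ->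
  exists N, forall n, (N <= n)%N -> visit_prob L i n `[- K, K] <= e.

Definition sign_differs n : set T :=
  [set w : T | (0 < position n w) != (0 < anchor i n w)].

Lemma measurable_pos_gt0 n : measurable [set w : T | 0 < position n w].
Proof.
rewrite -[X in measurable X]setTI -preimage_itvoy.
by apply: measurable_position => //; exact: measurable_itv.
Qed.

Lemma measurable_anchor_gt0 n : measurable [set w : T | 0 < anchor i n w].
Proof.
rewrite -[X in measurable X]setTI -preimage_itvoy.
by apply: measurable_anchor => //; exact: measurable_itv.
Qed.

Lemma measurable_sign_differs n : measurable (sign_differs n).
Proof.
have m1 := measurable_pos_gt0 n; have m2 := measurable_anchor_gt0 n.
rewrite (_ : sign_differs n =
  ([set w : T | 0 < position n w] `\` [set w : T | 0 < anchor i n w]) `|`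
  ([set w : T | 0 < anchor i n w] `\` [set w : T | 0 < position n w])).
  by apply: measurableU; exact: measurableD.
apply/seteqP; split => w; rewrite /sign_differs /=.
  by case: (0 < position n w); case: (0 < anchor i n w) => // _; [left|right].
by case: (0 < position n w); case: (0 < anchor i n w) => // -[] [].
Qed.

(** The event is split by the age a of the last visit. Ages beyond [A] are unlikely uniformly in n.
    For each of the [A.+1] other ages, either that visit happens within [K] of the origin or the
    later displacement exceeds [K]. [A] is chosen before [K] and [K] before [N]; old visits cost e /
    4 and the rest twice e / 4. *)
Lemma sign_differs_small e : 0 < e ->
  exists N, forall n, (N <= n)%N -> P (sign_differs n) <= e.
Proof.
move=> e0; have e4 : 0 < e / 4 by rewrite divr_gt0.
have [A hA] := bounded_sum_tail (f := fun a => P (av i 1 a)) (fun n => prob_ge0 _ _) summable e4.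
have eA : 0 < e / 4 / A.+1%:R by rewrite divr_gt0// ltr0n.
have [K hK] := position_tight A eA; have [N hN] := escapes K eA.
(* This makes [n - a] at least [N] for every age a up to [A]. *)
exists (A + N)%N => n nAN.
pose near a := [set w : T | state (n - a) w = i] `&`
  [set w : T | `[- K, K]%classic (position (n - a) w)].
pose far a := [set w : T | state (n - a) w = i] `&`
  sh (n - a) @^-1` [set w : T | K < `|position a w|].
have mnear a : measurable (near a).
  by apply: measurableI; [exact: measurable_state|exact: measurable_position_in].
have mfar a : measurable (far a).
  apply: measurableI; first exact: measurable_state.
  by apply: measurable_shift_preimage; exact: measurable_far.
have mav := measurable_avoids (R := R) (i0 := i0) i (n - A) n.
pose U := \big[setU/set0]_(a < A.+1) (near a `|` far a).
have mU : measurable U by apply: bigsetU_measurable => a _; exact: measurableU.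
have cover : sign_differs n `<=` av i (n - A) n `|` U.
  move=> w wn; have [?|nav] := pselect (av i (n - A) n w); [by left|right].
  have [k [kn wk mx]] : exists k, [/\ (n - A <= k <= n)%N, state k w = i & av i k.+1 n w].
    have ex : exists k, (n - A <= k <= n)%N && (state k w == i).
      apply: contrapT => nex; apply: nav => k kn wk; apply: nex; exists k.
      by rewrite kn; apply/eqP.
    have ub k : (n - A <= k <= n)%N && (state k w == i) -> (k <= n)%N by move=> /andP[/andP[]].
    case: (ex_maxnP ex ub) => k /andP[kn /eqP wk] mx; exists k; split => // l /andP[kl ln] wl.
    have := mx l; rewrite wl eqxx andbT ln andbT => /(_ ltac:(lia)).
    by rewrite leqNgt kl.
  rewrite /U -(bigcup_mkord A.+1 (fun a => near a `|` far a)); exists (n - k)%N; first by rewrite /=; lia.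
  have nk : (n - (n - k) = k)%N by lia.
  have kn' : (k <= n)%N by lia.
  have anc : anchor i n w = position k w.
    by rewrite (anchor_avoids kn' mx) anchor_visit.
  have pos : position n w = position k w + position (n - k) (sh k w).
    by rewrite -position_shift subnKC.
  have [yK|yK] := leP `|position k w| K; [left|right; split]; rewrite /= ?nk//.
    by split => /=; rewrite nk// in_itv/= -ler_norml.
  rewrite ltNge; apply/negP => zK; move: wn; rewrite /sign_differs /= anc pos.
  move: (position k w) (position (n - k) (sh k w)) yK zK => y z yK; rewrite ler_norml => /andP[z1 z2].
  move: yK; case: (ger0P y) => y0 yK.
    have -> : 0 < y + z by lra.
    by have -> : 0 < y by lra.
  have /negbTE -> : ~~ (0 < y + z) by rewrite -leNgt; lra.
  by have /negbTE -> : ~~ (0 < y) by rewrite -leNgt; lra.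
apply: (@le_trans _ _ (e / 4 + \sum_(a < A.+1) (e / 4 / A.+1%:R + e / 4 / A.+1%:R))); last first.
  by rewrite sumr_const card_ord -[X in _ + X <= _]mulr_natr mulrDl divfK ?pnatr_eq0//; lra.
apply: (le_trans (le_prob _ _ _ cover)).
- exact: measurable_sign_differs.
- exact: measurableU.
apply: (le_trans (prob_leU _ mav mU)); apply: lerD.
  apply: (le_trans (prob_avoids_le i LP (leq_subr A n))).
  apply: le_trans (hA (n - A)%N); rewrite (reindex_inj rev_ord_inj)/=.
  apply: ler_sum => k _; have kA := ltn_ord k.
  (* Summed backwards, the avoided stretches have length [(A + k).+1], one more than in the tail sum
     bounded by [hA]; the longer stretch is the less likely one. *)
  have -> : (n - (n - A - k.+1))%N = (A + k).+1 by lia.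
  apply: le_prob; [exact: measurable_avoids|exact: measurable_avoids|].
  by move=> w h l hl; apply: h; lia.
apply: (le_trans (prob_bigU _ (fun a _ => measurableU _ _ (mnear a) (mfar a)))).
apply: ler_sum => a _; apply: (le_trans (prob_leU _ (mnear a) (mfar a))).
have aA := ltn_ord a; apply: lerD; first by apply: hN; lia.
have := markov LP i (n := n - a) i (B := setT) measurableT (fun _ _ _ _ => Logic.I) (measurable_far K a).
rewrite setTI => ->; apply: le_trans (hK a _); last by lia.
by rewrite ler_piMl ?prob_ge0// prob_le1//; exact: measurable_state.
Qed.

End sign_of_anchor.

(** * Analytic estimates *)

Lemma unit_interval_modulus (R : realType) (f : R -> R) (B e : R) :
  continuous f -> (forall x, `|f x| <= B) -> 0 < e ->
  exists2 c, 0 <= c & forall x y, 0 <= x <= 1 -> 0 <= y <= 1 ->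
    `|f x - f y| <= e + c * `|x - y|.
Proof.
move=> cf fB e0; have B0 : 0 <= B := le_trans (normr_ge0 (f 0)) (fB 0).
have : \forall d \near (0 : R)^'+, `[0, 1]%classic `<=`
    [set x | forall y, `|x - y| < d -> `|f x - f y| <= e].
  have /compact_near_coveringP := @segment_compact R 0 1.
  apply => x _.
  have /cvgrPdist_lt /(_ (e / 2)) := cf x; rewrite divr_gt0// => /(_ isT).
  move=> /nbhs_ballP [d /= d0 hd].
  have d2 : 0 < d / 2 by rewrite divr_gt0.
  exists (ball x (d / 2), [set z | z < d / 2]); first split => //=.
  - exact: nbhsx_ballx.
  - exact: nbhs_right_lt.
  move=> [x' z] [/= xx' zd] y x'y.
  have h1 := hd x'; have h2 := hd y.
  rewrite /ball /= in xx' h1 h2.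
  have {}h1 : `|f x - f x'| < e / 2 by apply: h1; lra.
  have {}h2 : `|f x - f y| < e / 2.
    apply: h2; rewrite (_ : x - y = (x - x') + (x' - y)); last by ring.
    by rewrite (le_lt_trans (ler_normD _ _))//; lra.
  rewrite (_ : f x' - f y = (f x - f y) - (f x - f x')); last by ring.
  by rewrite (le_trans (ler_normB _ _))//; lra.
move=> /filterI /(_ (nbhs_right_gt 0)) /filter_ex [d [hd /= d0]].
(* Below distance [d] uniform continuity gives [e]; from [d] on, the slope absorbs the trivial bound
   [2 * B]. An affine bound can be integrated, so a small mean distance between occupation fractions
   suffices later. *)
exists (2 * B / d); first by rewrite divr_ge0 ?mulr_ge0// ltW.
move=> x y x01 y01; have [xy|xy] := ltP `|x - y| d.
  have xK : `[0, 1]%classic x by rewrite /= in_itv.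
  rewrite (le_trans (hd x xK y xy))//.
  by rewrite lerDl !mulr_ge0// invr_ge0 ltW.
have := fB x; have := fB y => fy fx.
rewrite (le_trans (ler_normB _ _))//.
have : 2 * B <= 2 * B / d * `|x - y|.
  by rewrite -mulrA ler_peMr ?mulr_ge0// ler_pdivlMl// mulr1.
by lra.
Qed.

Lemma average_cvg0 (R : realType) (d : nat -> R) : d @ \oo --> 0 ->
  (fun n => n%:R^-1 * \sum_(1 <= k < n.+1) d k) @ \oo --> 0.
Proof.
move=> d0; rewrite -cvg_shiftS.
have -> : [sequence n.+1%:R^-1 * \sum_(1 <= k < n.+2) d k]_n =
    arithmetic_mean (fun n => d n.+1).
  by apply/funext => n; rewrite /arithmetic_mean /series /= big_add1.
by apply: cesaro; rewrite cvg_shiftS.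
Qed.

Section integral_comparison.
Context {R : realType} {d} {T : measurableType d} (P : probability T R).

Lemma bounded_integrable (g : T -> R) (B : R) : measurable_fun [set: T] g ->
  (forall x, `|g x| <= B) -> P.-integrable setT (EFin \o g).
Proof.
move=> mg gB; apply: measurable_bounded_integrable => //.
  by rewrite ltey_eq fin_num_measure.
exists B; split; first exact: num_real.
by move=> x Bx y _ /=; exact: le_trans (ltW Bx).
Qed.

Lemma Rintegral_close (g h : T -> R) (B e c : R) n (D : nat -> set T) :
  measurable_fun [set: T] g -> measurable_fun [set: T] h ->
  (forall x, `|g x| <= B) -> (forall x, `|h x| <= B) ->
  0 <= e -> 0 <= c -> (forall k, measurable (D k)) ->
  (forall x, `|g x - h x| <= e + c * \sum_(k < n) \1_(D k) x) ->
  `|\int[P]_x g x - \int[P]_x h x| <= e + c * \sum_(k < n) prob P (D k).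
Proof.
move=> mg mh gB hB e0 c0 mD gh.
have ig := bounded_integrable mg gB; have ih := bounded_integrable mh hB.
have igh : P.-integrable setT (EFin \o (g \- h)).
  by apply: bounded_integrable (measurable_funB mg mh) _ => x;
    exact: le_trans (ler_normB _ _) (lerD (gB x) (hB x)).
rewrite -RintegralB//; apply: (le_trans (le_normr_Rintegral _ igh)) => //.
have mI k : measurable_fun setT (\1_(D k) : T -> R) by exact: measurable_indic.
have iI k : (\int[P]_x (\1_(D k) x)%:E = (prob P (D k))%:E)%E.
  by rewrite integral_indic// setIT; exact: probE.
have iS : (\int[P]_x (e + c * \sum_(k < n) \1_(D k) x)%:E =
    (e + c * \sum_(k < n) prob P (D k))%:E)%E.
  under eq_integral do rewrite EFinD EFinM -sumEFin.
  have mS : measurable_fun setT (fun x => \sum_(k < n) (\1_(D k) x)%:E : \bar R)%E.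
    by apply: emeasurable_sum => k; exact/measurable_EFinP.
  rewrite ge0_integralD//; last 2 first.
  - by move=> x _; rewrite mule_ge0// sume_ge0// => k _; rewrite lee_fin.
  - exact: emeasurable_funM.
  rewrite ge0_integralZl//; last first.
    by move=> x _; rewrite sume_ge0// => k _; rewrite lee_fin.
  rewrite ge0_integral_sum//; last by move=> k; exact/measurable_EFinP.
  rewrite (_ : \int[P]_x e%:E = e%:E)%E; last first.
    by rewrite integral_cst// -[RHS]mule1; congr (_ * _)%E; exact: probability_setT.
  rewrite EFinD EFinM -sumEFin.
  by congr (_ + _ * _)%E; apply: eq_bigr => k _; exact: iI.
have inorm : P.-integrable setT (EFin \o (fun x => `|(g \- h) x|)).
  exact: integrable_norm.
rewrite -lee_fin -iS /Rintegral fineK; last exact: integrable_fin_num.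
apply: ge0_le_integral => //.
- by apply/measurable_EFinP; apply: measurableT_comp => //; exact: measurable_funB.
- apply/measurable_EFinP; apply: measurable_funD => //; apply: measurable_funM => //.
  by apply: measurable_sum => k; exact: mI.
- by move=> x _; rewrite lee_fin; exact: gh.
Qed.

End integral_comparison.

(** * Comparison of the two walks *)

Section comparison.
Context {R : realType} {S : countType} {i0 : S} (i : S).
Local Notation T := (@trajectory R S i0).
Local Notation T2 := (@trajectory R bool true).
Local Notation sd := (@sign_differs R S i0 i).
Variables (P P' : probability T R).
Hypothesis same_embed : forall B : set T2, measurable B ->
  P ((embed i : T -> T2) @^-1` B) = P' ((embed i : T -> T2) @^-1` B).
Hypothesis sdP : prob P (sd n) @[n --> \oo] --> (0 : R).
Hypothesis sdP' : prob P' (sd n) @[n --> \oo] --> (0 : R).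

Lemma prob_symdiff_le (Q : probability T R) (A B D : set T) :
  measurable A -> measurable B -> measurable D ->
  A `<=` B `|` D -> B `<=` A `|` D -> `|prob Q A - prob Q B| <= prob Q D.
Proof.
move=> mA mB mD AB BA; rewrite ler_distl; apply/andP; split.
  rewrite lerBlDr (le_trans _ (prob_leU _ _ _))//; apply: le_prob => //.
  exact: measurableU.
rewrite (le_trans _ (prob_leU _ _ _))//; apply: le_prob => //.
exact: measurableU.
Qed.

Lemma sign_differs_close (Q : probability T R) n :
  `|prob Q [set w : T | 0 < position n w] - prob Q [set w : T | 0 < anchor i n w]|
    <= prob Q (sd n).
Proof.
apply: prob_symdiff_le => [||||w /= h].
- exact: measurable_pos_gt0.
- exact: measurable_anchor_gt0.
- exact: measurable_sign_differs.
- move=> w /= h; have [?|h'] := boolP (0 < anchor i n w); first by left.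
  by right; rewrite /sign_differs /= h (negbTE h').
- have [?|h'] := boolP (0 < position n w); first by left.
  by right; rewrite /sign_differs /= h (negbTE h').
Qed.

Lemma prob_anchor_eq n :
  prob P [set w : T | 0 < anchor i n w] = prob P' [set w : T | 0 < anchor i n w].
Proof.
have := same_embed (measurable_pos_gt0 (i0 := true) n).
rewrite (_ : _ @^-1` _ = [set w : T | 0 < anchor i n w]).
  by rewrite /prob => ->.
by apply/seteqP; split => w; rewrite /= position_embed.
Qed.

Lemma prob_position_close :
  prob P' [set w : T | 0 < position n w] - prob P [set w : T | 0 < position n w]
    @[n --> \oo] --> (0 : R).
Proof.
have : prob P (sd n) + prob P' (sd n) @[n --> \oo] --> (0 : R).
  by rewrite -[X in _ --> X]addr0; exact: cvgD.
move=> h; apply/cvgr0Pnorm_le => e e0; move/cvgr0Pnorm_le : h => /(_ e e0).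
apply: filterS => n; rewrite ger0_norm ?addr_ge0 ?prob_ge0//; apply: le_trans.
have := sign_differs_close P n; have := sign_differs_close P' n.
rewrite prob_anchor_eq !ler_norml => /andP[? ?] /andP[? ?].
by apply/andP; split; lra.
Qed.

Definition occupation (a : nat -> T -> R) n (w : T) : R :=
  n%:R^-1 * \sum_(1 <= k < n.+1) (0 < a k w)%R%:R.

Lemma occupation_itv a n w : 0 <= occupation a n w <= 1.
Proof.
apply/andP; split; first by rewrite mulr_ge0 ?invr_ge0// sumr_ge0.
case: n => [|n]; first by rewrite /occupation invr0 mul0r.
rewrite /occupation ler_pdivrMl ?ltr0n// mulr1 (@le_trans _ _ (\sum_(1 <= k < n.+2) 1))//.
  by apply: ler_sum => k _; case: (0 < a k w).
by rewrite big_const_nat iter_addr_0 subn1.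
Qed.

Lemma measurable_occupation a n : (forall k, measurable_fun [set: T] (a k)) ->
  measurable_fun [set: T] (occupation a n).
Proof.
move=> ma; apply: measurable_funM => //; apply: measurable_sum => k.
rewrite (_ : (fun w => _) = \1_[set w : T | 0 < a k w]).
  apply: measurable_indic; rewrite -[X in measurable X]setTI -preimage_itvoy.
  by apply: ma.
apply/funext => w; rewrite indicE; congr ((nat_of_bool _)%:R).
by apply/idP/idP; rewrite inE.
Qed.

Lemma occupation_close n w :
  `|occupation (@position R S i0) n w - occupation (@anchor R S i0 i) n w| <=
  n%:R^-1 * \sum_(k < n) \1_(sd k.+1) w.
Proof.
rewrite /occupation -mulrBr -sumrB normrM ger0_norm ?invr_ge0//.
rewrite ler_wpM2l ?invr_ge0// (le_trans (ler_norm_sum _ _ _))//.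
rewrite big_add1 big_mkord; apply: ler_sum => k _; rewrite indicE.
have [d|/negbTE d] := boolP (w \in sd k.+1).
  by case: (0 < _); case: (0 < _); rewrite ?subrr ?subr0 ?sub0r ?normrN ?normr1 ?normr0.
suff -> : (0 < position k.+1 w) = (0 < anchor i k.+1 w) by rewrite subrr normr0.
by apply/eqP/negPn/negP => h; move/negP: d; apply; rewrite inE.
Qed.

(** The occupation fraction of the anchor factors through [embed], under which [P] and [P'] have the
    same image. *)
Lemma expectation_anchor_eq (f : R -> R) (B : R) n : continuous f -> (forall x, `|f x| <= B) ->
  \int[P]_w f (occupation (@anchor R S i0 i) n w) =
  \int[P']_w f (occupation (@anchor R S i0 i) n w).
Proof.
move=> cf fB; have mf : measurable_fun [set: R] f by exact: continuous_measurable_fun.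
pose occ2 (v : T2) := n%:R^-1 * \sum_(1 <= k < n.+1) (0 < position k v)%R%:R : R.
have mocc2 : measurable_fun [set: T2] (EFin \o (f \o occ2)).
  apply/measurable_EFinP; apply: measurableT_comp => //; apply: measurable_funM => //.
  apply: measurable_sum => k.
  rewrite (_ : (fun w => _) = \1_[set v : T2 | 0 < position k v]).
    by apply: measurable_indic; exact: measurable_pos_gt0.
  apply/funext => w; rewrite indicE; congr ((nat_of_bool _)%:R).
  by apply/idP/idP; rewrite inE.
have me : measurable_fun [set: T] (embed i : T -> T2) by exact: measurable_embed.
have occE w : occupation (@anchor R S i0 i) n w = occ2 (embed i w).
  by rewrite /occupation /occ2; congr (_ * _); apply: eq_bigr => k _; rewrite position_embed.
have push (Q : probability T R) : \int[Q]_w f (occupation (@anchor R S i0 i) n w) =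
    fine (\int[pushforward Q (embed i : T -> T2)]_v (f (occ2 v))%:E)%E.
  rewrite /Rintegral; congr fine.
  rewrite (integral_pushforward me mocc2)//; last first.
    rewrite preimage_setT; apply: (bounded_integrable (g := f \o occ2 \o embed i) _ (B := B)) => //.
      by apply/measurable_EFinP; apply: measurableT_comp mocc2 me.
    by move=> w; exact: fB.
  by rewrite ?preimage_setT; apply: eq_integral => w _; rewrite occE.
rewrite !push; congr fine; apply: eq_measure_integral => A mA _.
exact: same_embed.
Qed.

Lemma expectation_occupation_close (f : R -> R) (B : R) :
  continuous f -> (forall x, `|f x| <= B) ->
  \int[P']_w f (occupation (@position R S i0) n w) -
  \int[P]_w f (occupation (@position R S i0) n w) @[n --> \oo] --> (0 : R).
Proof.
move=> cf fB.
have mf : measurable_fun [set: R] f by exact: continuous_measurable_fun.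
have m1 n : measurable_fun [set: T] (fun w => f (occupation (@position R S i0) n w)).
  by apply: measurableT_comp => //; apply: measurable_occupation => k; exact: measurable_position.
have m2 n : measurable_fun [set: T] (fun w => f (occupation (@anchor R S i0 i) n w)).
  by apply: measurableT_comp => //; apply: measurable_occupation => k; exact: measurable_anchor.
have avg (Q : probability T R) : prob Q (sd n) @[n --> \oo] --> (0 : R) ->
    n%:R^-1 * \sum_(k < n) prob Q (sd k.+1) @[n --> \oo] --> (0 : R).
  move=> /average_cvg0; rewrite (_ : (fun n => _) = (fun n => n%:R^-1 * \sum_(k < n) prob Q (sd k.+1)))//.
  by apply/funext => n; rewrite big_add1 big_mkord.
have h : n%:R^-1 * (\sum_(k < n) prob P (sd k.+1)) +
    n%:R^-1 * (\sum_(k < n) prob P' (sd k.+1)) @[n --> \oo] --> (0 : R).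
  by rewrite -[X in _ --> X]addr0; apply: cvgD; exact: avg.
apply/cvgr0Pnorm_le => e e0; have e4 : 0 < e / 4 by rewrite divr_gt0.
have [c c0 hc] := unit_interval_modulus cf fB e4.
(* The two moduli cost e / 2 together, which leaves e / 2 for the averaged sign differences
   multiplied by [c]; dividing by [c + 1] covers [c = 0]. *)
have d0 : 0 < e / 2 / (c + 1) by rewrite !divr_gt0// ltr_wpDl.
move/cvgr0Pnorm_le : h => /(_ _ d0); apply: filterS => n; rewrite /= => hn.
have close (Q : probability T R) :
  `|\int[Q]_w f (occupation (@position R S i0) n w) -
    \int[Q]_w f (occupation (@anchor R S i0 i) n w)| <=
    e / 4 + c * (n%:R^-1 * \sum_(k < n) prob Q (sd k.+1)).
  rewrite mulrA; apply: (@Rintegral_close _ _ _ Q _ _ B _ _ n (fun k => sd k.+1)) => //.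
  - exact: ltW.
  - by rewrite mulr_ge0// invr_ge0.
  - by move=> k; exact: measurable_sign_differs.
  - move=> w; rewrite (le_trans (hc _ _ (occupation_itv _ _ _) (occupation_itv _ _ _)))//.
    by rewrite lerD2l -mulrA ler_wpM2l// occupation_close.
have := close P; have := close P'; rewrite -(expectation_anchor_eq n cf fB).
move: (\int[P]_w _) (\int[P']_w _) (\int[P]_w _) hn => x y z.
set s := n%:R^-1 * _; set s' := n%:R^-1 * _ => hn h1 h2.
have hs : s + s' <= e / 2 / (c + 1) by rewrite (le_trans (ler_norm _) hn).
have hcs : c * (s + s') <= e / 2.
  have s0 : 0 <= s + s'.
    by rewrite addr_ge0// mulr_ge0 ?invr_ge0// sumr_ge0// => k _; exact: prob_ge0.
  rewrite (@le_trans _ _ ((c + 1) * (s + s')))//; first by rewrite ler_wpM2r// lerDl.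
  by rewrite mulrC -ler_pdivlMr// ltr_wpDl.
by move: h1 h2; rewrite !ler_norml => /andP[? ?] /andP[? ?]; apply/andP; split; lra.
Qed.

End comparison.

(** * From the probability spaces to trajectories *)

Section path_law.
Context {R : realType} {S : countType} {d : measure_display} {Omega : measurableType d}.
Variables (i0 : S) (M : nat -> Omega -> S) (X : nat -> Omega -> R).
Local Notation T := (@trajectory R S i0).

Definition path_of (w : Omega) : T := fun k => (M k w, X k w).

Hypothesis mM : forall n j, measurable [set w | M n w = j].
Hypothesis mX : forall n, measurable_fun [set: Omega] (X n).

Lemma measurable_path_of : measurable_fun [set: Omega] path_of.
Proof. by apply: measurable_into_trajectory => [k j|k]; [exact: mM|exact: mX]. Qed.

Lemma path_law_exists (Pr : S -> probability Omega R) :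
  exists L : S -> probability T R, forall j B, L j B = Pr j (path_of @^-1` B).
Proof.
pose W : {mfun Omega >-> T} :=
  HB.pack path_of (isMeasurableFun.Build _ _ _ _ path_of measurable_path_of).
by exists (fun j => distribution (Pr j) W).
Qed.

End path_law.

Lemma markov_random_walk_chain_law (R : realType) (S : countType) (i0 : S)
    (d : measure_display) (Omega : measurableType d)
    (Pr : S -> probability Omega R) (M : nat -> Omega -> S) (X : nat -> Omega -> R)
    (p : S -> S -> R) (K : S -> S -> probability (measurableTypeR R) R)
    (L : S -> probability (@trajectory R S i0) R) :
  markov_random_walk Pr M X p K ->
  (forall j B, L j B = Pr j (path_of i0 M X @^-1` B)) ->
  chain_law L (fun j k A => p j k * fine (K j k A)).
Proof.
move=> [_ _ hpath hrect] LE j n s A mA; rewrite LE.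
rewrite (_ : _ @^-1` _ =
  path_event M n s `&` [set w | forall k, (k < n)%N -> A k (X k w)])//.
rewrite hrect// hpath big_split/= mulrA [RHS]EFinM; congr (_ * _)%E.
rewrite -prodEFin; apply: eq_bigr => k _.
by rewrite fineK//; apply: fin_num_measure; exact: mA.
Qed.

(** * Return epochs *)

Lemma next_visitP (S : countType) (x : nat -> S) (i : S) m n : next_visit x i m = Some n <->
  [/\ (m < n)%N, x n = i & forall l, (m < l < n)%N -> x l <> i].
Proof.
rewrite /next_visit; case: pselect => [ex|nex]; last first.
  by split => // -[mn xn _]; exfalso; apply: nex; exists n; rewrite mn xn eqxx.
case: ex_minnP => k /andP[mk /eqP xk] mn; split.
  move=> [<-]; split => // l /andP[ml lk] xl.
  by have := mn l; rewrite ml xl eqxx => /(_ isT); rewrite leqNgt lk.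
move=> [h1 h2 h3]; congr Some; apply/eqP; rewrite eqn_leq mn ?h1 ?h2 ?eqxx//=.
by rewrite leqNgt; apply/negP => kn; apply: (h3 k) => //; rewrite mk.
Qed.

Lemma next_visit_embed (S : countType) (x : nat -> S) (i : S) m :
  next_visit (fun n => x n == i) true m = next_visit x i m.
Proof.
have e n : next_visit (fun n => x n == i) true m = Some n <-> next_visit x i m = Some n.
  split=> /next_visitP[h1 h2 h3]; apply/next_visitP; split.
  - exact: h1.
  - by apply/eqP; rewrite h2.
  - by move=> l /h3 h xl; apply: h; rewrite xl eqxx.
  - exact: h1.
  - by rewrite h2 eqxx.
  - by move=> l /h3 h /eqP.
case E : (next_visit x i m) => [n|]; first exact/e.
by case E' : (next_visit _ _ _) => [n|//]; rewrite (proj1 (e n) E') in E.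
Qed.

(** Return epochs depend only on which times are visits, and this information survives in the
    embedded walk; (b) thereby becomes a statement about that walk. *)
Lemma return_epoch_embed (S : countType) (x : nat -> S) (i : S) k :
  return_epoch (fun n => x n == i) true k = return_epoch x i k.
Proof.
elim: k => //= k ->; case: (return_epoch x i k) => //= m; exact: next_visit_embed.
Qed.

Lemma return_epoch_state (S : countType) (x : nat -> S) (i : S) k m :
  return_epoch x i k = Some m -> m = 0%N \/ x m = i.
Proof.
case: k => [[<-]|k] /=; first by left.
by case: (return_epoch x i k) => //= l /next_visitP[_ xm _]; right.
Qed.

Section return_epochs_of_trajectories.
Context {R : realType} {S : countType}.
Variable i0 : S.
Local Notation T := (@trajectory R S i0).

Lemma measurable_return_epoch (i : S) k m :
  measurable [set w : T | return_epoch (fun n => state n w) i k = Some m].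
Proof.
elim: k m => [|k IH] m /=.
  have [->|m0] := eqVneq m 0%N.
    by rewrite (_ : [set w | _] = setT)//; apply/seteqP; split.
  rewrite (_ : [set w | _] = set0)//; apply/seteqP; split => // w /= [] e.
  by rewrite -e eqxx in m0.
rewrite (_ : [set w | _] = \bigcup_(l in [set l | (l < m)%N])
  ([set w : T | return_epoch (fun n => state n w) i k = Some l] `&`
   ([set w : T | state m w = i] `&` avoids i l.+1 m.-1))).
  apply: bigcup_measurable => l _; apply: measurableI => //.
  by apply: measurableI; [exact: measurable_state|exact: measurable_avoids].
apply/seteqP; split => w /=.
  case E : (return_epoch _ i k) => [l|//] /= /next_visitP[lm wm h].
  by exists l => //; split => //; split => // j jl; apply: h; lia.
move=> [l /= lm [-> [wm h]]] /=; apply/next_visitP; split => // j jl; apply: h; lia.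
Qed.

Definition positive_at_return (i : S) k : set T :=
  [set w | if return_epoch (fun n => state n w) i k is Some m then 0 < position m w
           else false].

Lemma measurable_positive_at_return (i : S) k : measurable (positive_at_return i k).
Proof.
rewrite (_ : positive_at_return i k = \bigcup_m
  ([set w : T | return_epoch (fun n => state n w) i k = Some m] `&`
   [set w : T | 0 < position m w])).
  apply: bigcupT_measurable => m; apply: measurableI.
    exact: measurable_return_epoch.
  exact: measurable_pos_gt0.
apply/seteqP; split => w; rewrite /positive_at_return /=.
  by case E : (return_epoch _ i k) => [m|//] h; exists m.
by move=> [m _ [/= -> h]].
Qed.

(** Tail summation: over a < n, the indicators of [avoids 1 a] add up to at most the minimum of n
    and the return time. *)
Lemma mean_return_time_summable (d : measure_display) (Omega : measurableType d)
    (P : probability Omega R) (M : nat -> Omega -> S) (X : nat -> Omega -> R) (i : S)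
    (L : probability T R) :
  (forall n j, measurable [set w | M n w = j]) ->
  (forall n, measurable_fun [set: Omega] (X n)) ->
  (forall B, L B = P (path_of i0 M X @^-1` B)) ->
  (\int[P]_w (if return_epoch (M ^~ w) i 1 is Some m then m%:R%:E else +oo) < +oo)%E ->
  exists C, forall n, \sum_(a < n) prob L (@avoids R S i0 i 1 a) <= C.
Proof.
move=> mM mX LE; set tau := (fun w => _) => tauoo.
have mp := @measurable_path_of _ _ _ _ i0 _ _ mM mX.
have mE m : measurable [set w | return_epoch (M ^~ w) i 1 = Some m].
  rewrite (_ : [set w | _] = path_of i0 M X @^-1`
    [set w : T | return_epoch (fun n => state n w) i 1 = Some m])//.
  by rewrite -[X in measurable X]setTI; apply: mp => //; exact: measurable_return_epoch.
have mtau : measurable_fun [set: Omega] tau.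
  move=> _ Y mY; rewrite setTI (_ : tau @^-1` Y =
    \bigcup_(m in [set m : nat | Y m%:R%:E]) [set w | return_epoch (M ^~ w) i 1 = Some m] `|`
    (if `[< Y +oo%E >] then ~` \bigcup_m [set w | return_epoch (M ^~ w) i 1 = Some m] else set0)).
    apply: measurableU; first by apply: bigcup_measurable.
    by case: ifP => // _; apply: measurableC; exact: bigcupT_measurable.
  apply/seteqP; split => w; rewrite /tau /preimage; cbv beta.
    rewrite /mkset; case E : (return_epoch _ _ _) => [m|] Yt; first by left; exists m.
    by right; case: asboolP => // _ [m _]; rewrite /mkset E.
  move=> [[m Ym e]|]; first by rewrite /mkset e.
  case: asboolP => // Yoo nE.
  rewrite /mkset; case E : (return_epoch _ _ _) => [m|//].
  by exfalso; apply: nE; exists m.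
have tau0 w : (0 <= tau w)%E by rewrite /tau; case: return_epoch => // m; rewrite lee_fin.
exists (fine (\int[P]_w tau w)%E) => n.
pose A a := path_of i0 M X @^-1` (@avoids R S i0 i 1 a).
have mA a : measurable (A a).
  by rewrite -[X in measurable X]setTI; apply: mp => //; exact: measurable_avoids.
rewrite -lee_fin fineK; last by rewrite ge0_fin_numE// integral_ge0.
rewrite -sumEFin (eq_bigr (fun a : 'I_n => \int[P]_w (\1_(A a) w)%:E)%E); last first.
  move=> a _; rewrite integral_indic// setIT -probE ?LE//.
  exact: measurable_avoids.
rewrite -ge0_integral_sum//; last first.
  by move=> a; apply/measurable_EFinP; exact: measurable_indic.
apply: ge0_le_integral => //.
- by move=> w _; rewrite sume_ge0// => a _; rewrite lee_fin.
- by apply: emeasurable_sum => a; apply/measurable_EFinP; exact: measurable_indic.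
move=> w _; rewrite /tau; case E : (return_epoch _ _ _) => [m|]; last by rewrite leey.
rewrite sumEFin lee_fin.
have /next_visitP[m0 wm _] : next_visit (M ^~ w) i 0 = Some m by [].
rewrite (@le_trans _ _ (\sum_(a < n) (a < m)%N%:R))//.
  apply: ler_sum => a _; rewrite indicE ler_nat; case: (boolP (w \in A a)) => //.
  rewrite inE => wa; rewrite lt0n eqb0 negbK ltnNge; apply/negP => ma.
  by apply: (wa m) => //; rewrite m0.
rewrite -natr_sum ler_nat; have -> : (\sum_(a < n) (a < m) = minn n m)%N.
  by elim: n => [|n IH]; rewrite ?big_ord0 ?min0n// big_ord_recr/= IH; lia.
exact: geq_minr.
Qed.

End return_epochs_of_trajectories.

(** * The assertions expressed on trajectories *)

Section transfer_to_paths.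
Context {R : realType} {S : countType} (i : S).
Local Notation T := (@trajectory R S i).
Context {d : measure_display} {Omega : measurableType d}.
Variables (Q : probability Omega R) (M : nat -> Omega -> S) (X : nat -> Omega -> R).
Variable P : probability T R.
Hypothesis mM : forall n j, measurable [set w | M n w = j].
Hypothesis mX : forall n, measurable_fun [set: Omega] (X n).
Hypothesis PE : forall B, P B = Q (path_of i M X @^-1` B).

Lemma expectation_path_of (g : T -> R) (B : R) : measurable_fun [set: T] g ->
  (forall v, `|g v| <= B) -> ('E_Q[fun w => g (path_of i M X w)] = (\int[P]_v g v)%:E)%E.
Proof.
move=> mg gB; have mp := @measurable_path_of _ _ _ _ i _ _ mM mX.
have ig := bounded_integrable P mg gB.
rewrite unlock /Rintegral fineK; last exact: integrable_fin_num.
rewrite (@eq_measure_integral _ _ _ _ (pushforward Q (path_of i M X)) P)//.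
  have mEg : measurable_fun setT (EFin \o g) by exact/measurable_EFinP.
  have iQ : Q.-integrable (path_of i M X @^-1` setT) ((EFin \o g) \o path_of i M X).
    rewrite preimage_setT; apply: (bounded_integrable (g := g \o path_of i M X) _ (B := B)).
      exact: measurableT_comp.
    by move=> w; exact: gB.
  by rewrite (integral_pushforward mp mEg iQ)// preimage_setT.
by move=> A mA _; exact: PE.
Qed.

Lemma expectation_positive_fraction (f : R -> R) (B : R) n : continuous f ->
  (forall x, `|f x| <= B) ->
  ('E_Q[fun w => f (n%:R^-1 * \sum_(1 <= k < n.+1) (0 < walk X k w)%R%:R)%R] =
   (\int[P]_v f (occupation (@position R S i) n v))%:E)%E.
Proof.
move=> cf fB.
have mf : measurable_fun [set: R] f by exact: continuous_measurable_fun.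
rewrite -(@expectation_path_of (fun v => f (occupation (@position R S i) n v)) B)//.
apply: measurableT_comp => //; apply: measurable_occupation => k.
exact: measurable_position.
Qed.

(** At n = 0 both fractions are 0 because [0^-1] is 0, and they do not add up to 1; limits using
    this identity are therefore taken along n + 1. *)
Lemma expectation_nonpositive_fraction (f : R -> R) n : (0 < n)%N ->
  ('E_Q[fun w => f (n%:R^-1 * \sum_(1 <= k < n.+1) (walk X k w <= 0)%R%:R)%R] =
   'E_Q[fun w => f (1 - n%:R^-1 * \sum_(1 <= k < n.+1) (0 < walk X k w)%R%:R)%R])%E.
Proof.
move=> n0; congr expectation; apply/funext => w; congr (f _).
have nn0 : n%:R != 0 :> R by rewrite pnatr_eq0 -lt0n.
move: (mulVf nn0) => e; rewrite -[X in _ = X - _]e -mulrBr; congr (_ * _).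
rewrite {e nn0}; have -> : n%:R = \sum_(1 <= k < n.+1) 1 :> R by rewrite big_const_nat iter_addr_0 subn1.
rewrite -sumrB; apply: eq_bigr => k _; rewrite leNgt.
by case: (0 < _); rewrite ?subrr ?subr0.
Qed.

Lemma prob_walk_gt0 n :
  fine (Q [set w | 0 < walk X n w]) = prob P [set v : T | 0 < position n v].
Proof. by rewrite /prob PE. Qed.

Lemma prob_walk_at_return k :
  fine (Q (walk_at_return_gt0 M X i k)) = prob P (@positive_at_return R S i i k).
Proof. by rewrite /prob PE. Qed.

End transfer_to_paths.

Lemma positive_at_return_embed (R : realType) (S : countType) (i0 i : S) k :
  @positive_at_return R S i0 i k =
  (embed i : trajectory i0 -> @trajectory R bool true) @^-1`
    @positive_at_return R bool true true k.
Proof.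
apply/seteqP; split => w; rewrite /positive_at_return /mkset /preimage /mkset.
  rewrite (_ : return_epoch (fun n => state n (embed i w)) true k =
    return_epoch (fun n => state n w) i k); last exact: return_epoch_embed.
  case E : (return_epoch _ i k) => [m|//]; rewrite position_embed.
  (* Epoch 0 is time 0 whatever the initial state, and there the position and the anchor are both
     0. *)
  by have [->|/anchor_visit->//] := return_epoch_state E; rewrite /position big_ord0.
rewrite (_ : return_epoch (fun n => state n (embed i w)) true k =
  return_epoch (fun n => state n w) i k); last exact: return_epoch_embed.
case E : (return_epoch _ i k) => [m|//]; rewrite position_embed.
by have [->|/anchor_visit->//] := return_epoch_state E; rewrite /position big_ord0.
Qed.

(** * Transfer of each assertion *)

Section assertion_transfer.
Context {R : realType} {S : countType} (i : S).
Local Notation T := (@trajectory R S i).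
Local Notation T2 := (@trajectory R bool true).
Context {d : measure_display} {Omega : measurableType d}.
Context {d' : measure_display} {Omega' : measurableType d'}.
Variables (Pr : S -> probability Omega R) (M : nat -> Omega -> S) (X : nat -> Omega -> R).
Variables (Pr' : S -> probability Omega' R) (M' : nat -> Omega' -> S) (X' : nat -> Omega' -> R).
Variables P P' : probability T R.
Hypothesis mM : forall n j, measurable [set w | M n w = j].
Hypothesis mX : forall n, measurable_fun [set: Omega] (X n).
Hypothesis PE : forall B, P B = Pr i (path_of i M X @^-1` B).
Hypothesis mM' : forall n j, measurable [set w | M' n w = j].
Hypothesis mX' : forall n, measurable_fun [set: Omega'] (X' n).
Hypothesis PE' : forall B, P' B = Pr' i (path_of i M' X' @^-1` B).
Hypothesis same_embed : forall B : set T2, measurable B ->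
  P ((embed i : T -> T2) @^-1` B) = P' ((embed i : T -> T2) @^-1` B).
Hypothesis sdP : prob P (@sign_differs R S i i n) @[n --> \oo] --> (0 : R).
Hypothesis sdP' : prob P' (@sign_differs R S i i n) @[n --> \oo] --> (0 : R).

(** The limit is an arbitrary extended real, so that integrals against the arcsine laws are carried
    along unevaluated. *)
Let cvg_close (u u' : nat -> R) (l : \bar R) : u' n - u n @[n --> \oo] --> (0 : R) ->
  (u n)%:E @[n --> \oo] --> l -> (u' n)%:E @[n --> \oo] --> l.
Proof.
move=> du ul; rewrite -[l]adde0.
rewrite (_ : (fun n => (u' n)%:E) = (fun n => ((u n)%:E + (u' n - u n)%:E)%E)).
  apply: cvgeD => //; first by rewrite fin_num_adde_defl.
  by apply: cvg_EFin => //; exact: nearW.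
by apply/funext => n; rewrite -EFinD addrC subrK.
Qed.

Lemma assertion_d_transfer rho :
  assertion_d Pr X i rho -> assertion_d Pr' X' i rho.
Proof.
rewrite /assertion_d => h.
have -> : (fun n => fine (Pr' i [set w | 0 < walk X' n w])) =
    (fun n => fine (Pr i [set w | 0 < walk X n w]) +
      (prob P' [set v : T | 0 < position n v] - prob P [set v : T | 0 < position n v])).
  apply/funext => n; rewrite (prob_walk_gt0 PE) (prob_walk_gt0 PE').
  by rewrite addrC subrK.
rewrite -[rho]addr0; apply: cvgD => //.
exact: (prob_position_close same_embed sdP sdP').
Qed.

Lemma assertion_c_transfer rho :
  assertion_c Pr X i rho -> assertion_c Pr' X' i rho.
Proof.
rewrite /assertion_c => h.
pose D n := prob P' [set v : T | 0 < position n v] - prob P [set v : T | 0 < position n v].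
have -> : (fun n => n%:R^-1 * \sum_(1 <= k < n.+1) fine (Pr' i [set w | 0 < walk X' k w])) =
    (fun n => n%:R^-1 * \sum_(1 <= k < n.+1) fine (Pr i [set w | 0 < walk X k w]) +
      n%:R^-1 * \sum_(1 <= k < n.+1) D k).
  apply/funext => n; rewrite -mulrDr -big_split/=; congr (_ * _); apply: eq_bigr => k _.
  by rewrite (prob_walk_gt0 PE) (prob_walk_gt0 PE') addrC subrK.
rewrite -[rho]addr0; apply: cvgD => //; apply: average_cvg0.
exact: (prob_position_close same_embed sdP sdP').
Qed.

Lemma assertion_b_transfer rho :
  assertion_b Pr M X i rho -> assertion_b Pr' M' X' i rho.
Proof.
rewrite /assertion_b (_ : (fun n => n%:R^-1 * \sum_(1 <= k < n.+1)
  fine (Pr i (walk_at_return_gt0 M X i k))) = (fun n => n%:R^-1 * \sum_(1 <= k < n.+1)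
  fine (Pr' i (walk_at_return_gt0 M' X' i k))))//.
apply/funext => n; congr (_ * _); apply: eq_bigr => k _.
rewrite (prob_walk_at_return PE) (prob_walk_at_return PE') positive_at_return_embed.
by rewrite /prob same_embed//; exact: measurable_positive_at_return.
Qed.

Lemma assertion_a_transfer rho :
  assertion_a Pr X i rho -> assertion_a Pr' X' i rho.
Proof.
move=> [h1 h2]; split => f cf [B fB].
  have e n := expectation_positive_fraction mM mX PE n cf fB.
  have e' n := expectation_positive_fraction mM' mX' PE' n cf fB.
  have := h1 f cf (ex_intro _ B fB); rewrite (eq_cvg _ _ e) (eq_cvg _ _ e').
  by apply: cvg_close; exact: (expectation_occupation_close same_embed sdP sdP' cf fB).
(* The fraction of nonpositive times is 1 minus that of positive times, so testing the former with
   [f] amounts to testing the latter with [g]. *)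
pose g x := f (1 - x).
have cg : continuous g.
  move=> x; apply: continuous_comp; last exact: cf.
  by apply: cvgB; [exact: cvg_cst|exact: cvg_id].
have gB x : `|g x| <= B by exact: fB.
have e n : _ = _ := etrans
  (expectation_nonpositive_fraction (Pr i) X f (ltn0Sn n))
  (expectation_positive_fraction mM mX PE n.+1 cg gB).
have e' n : _ = _ := etrans
  (expectation_nonpositive_fraction (Pr' i) X' f (ltn0Sn n))
  (expectation_positive_fraction mM' mX' PE' n.+1 cg gB).
have := h2 f cf (ex_intro _ B fB).
rewrite -cvg_shiftS -[X in _ -> X]cvg_shiftS (eq_cvg _ _ e) (eq_cvg _ _ e').
apply: (cvg_close (u := fun n => \int[P]_w g (occupation (@position R S i) n.+1 w))
  (u' := fun n => \int[P']_w g (occupation (@position R S i) n.+1 w))).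
have := expectation_occupation_close same_embed sdP sdP' cg gB.
by rewrite -cvg_shiftS.
Qed.

End assertion_transfer.

(** * Positivity of the stationary distribution *)

Lemma esum_ge_term (R : realType) (S : countType) (a : S -> \bar R) (j : S) :
  (forall k, 0 <= a k)%E -> (a j <= \esum_(k in [set: S]) a k)%E.
Proof.
move=> a0; apply: esum_ge; exists [set j]; last by rewrite fsbig_set1.
by split => //; exact: finite_set1.
Qed.

Section stationary_positivity.
Context {R : realType} {S : countType} {i0 : S}.
Local Notation T := (@trajectory R S i0).
Variables (p : S -> S -> R) (pi_ : S -> R).
Variables (L : S -> probability T R) (kappa : S -> S -> set R -> R).
Hypothesis LP : chain_law L kappa.
Hypothesis kappaT : forall j k, kappa j k setT = p j k.
Hypothesis stat : stationary_distribution p pi_.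
Hypothesis p_ge0 : forall j k, 0 <= p j k.
Hypothesis irreducible : forall j k, exists n, 0 < prob (L j) [set w : T | state n w = k].

Lemma prob_one_step j k : prob (L j) [set w : T | state 1 w = k] <= p j k.
Proof.
have mA : measurable_family (fun=> setT : set R) by [].
pose s n := if n is 0 then j else k.
have -> : p j k = prob (L j) (cylinder 1 s (fun=> setT)).
  by rewrite /prob LP// big_ord1 /= eqxx mul1r kappaT.
apply: (le_prob_start LP).
- exact: measurable_state.
- exact: measurable_cylinder.
- by move=> w w0 w1; split => // -[|[|n]].
Qed.

Lemma stationary_step j n k : 0 < pi_ j -> 0 < prob (L j) [set w : T | state n w = k] ->
  0 < pi_ k.
Proof.
move=> pj; elim: n k => [|n IH] k.
  have [->//|kj] := eqVneq k j.
  have m0 l : measurable [set w : T | state 0 w = l] by exact: measurable_state.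
  have : prob (L j) [set w : T | state 0 w = k] <= prob (L j) set0.
    by apply: (le_prob_start LP) => // w /= -> jk; rewrite jk eqxx in kj.
  by rewrite prob0; lra.
move=> h.
have [l hl] : exists l, 0 < prob (L j) ([set w : T | state n.+1 w = k] `&` [set w : T | state n w = l]).
  apply: contrapT => nex; move: h; rewrite /prob.
  rewrite (measure_fibers_eq0 (f := state n) (measurable_state n)) ?ltxx//.
    exact: measurable_state.
  move=> l; have mE : measurable ([set w : T | state n.+1 w = k] `&` [set w : T | state n w = l]).
    by apply: measurableI; exact: measurable_state.
  apply: (etrans (probE (L j) mE)); congr EFin; apply/eqP; rewrite eq_le prob_ge0 andbT leNgt; apply/negP => ?.
  by apply: nex; exists l.
have m1 : measurable [set w : T | state 1 w = k] by exact: measurable_state.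
have := markov LP j (n := n) l measurableT (fun _ _ _ _ => Logic.I) m1.
rewrite setTI (_ : _ `&` _ = [set w : T | state n.+1 w = k] `&` [set w : T | state n w = l]).
  move=> e; move: hl; rewrite e => hl.
  have hl1 : 0 < prob (L j) [set w : T | state n w = l].
    by rewrite lt0r prob_ge0 andbT; apply: contraTneq hl => ->; rewrite mul0r ltxx.
  have hp : 0 < p l k.
    apply: lt_le_trans (prob_one_step l k).
    by rewrite lt0r prob_ge0 andbT; apply: contraTneq hl => ->; rewrite mulr0 ltxx.
  have [pi0 _ /(_ k) st] := stat.
  rewrite (lt_le_trans (mulr_gt0 (IH _ hl1) hp))// -lee_fin -st.
  apply: (@esum_ge_term R S (fun i => (pi_ i * p i k)%:E)) => m.
  by rewrite lee_fin mulr_ge0.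
by rewrite setIC; apply/seteqP; split => w [] /= h1 h2; split => //; rewrite /= -?h1 -?h2 state_shift addn1.
Qed.

(** Some state has positive mass because the total is 1, and stationarity propagates mass along
    every path of positive probability. The dual transition matrix divides by these weights. *)
Lemma stationary_gt0 k : 0 < pi_ k.
Proof.
have [pi0 pi1 _] := stat.
have [j pj] : exists j, 0 < pi_ j.
  apply: contrapT => nex; move: pi1; rewrite esum1.
    by move=> /eqP; rewrite eq_sym onee_eq0.
  move=> j _; congr EFin; apply/eqP; rewrite eq_le pi0 andbT leNgt; apply/negP => ?.
  by apply: nex; exists j.
by have [n hn] := irreducible j k; exact: stationary_step hn.
Qed.

End stationary_positivity.

Theorem corollary1p9 (R : realType) (S : countType)
  (p : S -> S -> R) (pi_ : S -> R)
  (K : S -> S -> probability (measurableTypeR R) R)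
  (* the Markov random walk *)
  (d : measure_display) (Omega : measurableType d)
  (Pr : S -> probability Omega R)
  (M : nat -> Omega -> S) (X : nat -> Omega -> R)
  (* its dual *)
  (d' : measure_display) (Omega' : measurableType d')
  (Pr' : S -> probability Omega' R)
  (M' : nat -> Omega' -> S) (X' : nat -> Omega' -> R) :
  transition_matrix p ->
  markov_random_walk Pr M X p K ->
  positive_recurrent_chain Pr M ->
  unique_stationary_distribution p pi_ ->
  nontrivial Pr M X ->
  markov_random_walk Pr' M' X' (dual_matrix p pi_) (dual_kernel K) ->
  forall rho : R, 0 <= rho <= 1 ->
    [/\ forall i, assertions_ac Pr M X i rho -> assertions_ac Pr' M' X' i rho,
        (forall i, assertions_ac Pr M X i rho) ->
          forall i, assertions_ac Pr' M' X' i rho,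
        forall i, assertions_ad Pr M X i rho -> assertions_ad Pr' M' X' i rho &
        (forall i, assertions_ad Pr M X i rho) ->
          forall i, assertions_ad Pr' M' X' i rho].
Proof.
move=> [p_ge0 _] mrw [irr mrt] [stat _] nontriv mrw' rho _.
(* Each of the four assertions passes to the dual on its own and at each state separately, which
   covers all four combinations. *)
suff H i : [/\ assertion_a Pr X i rho -> assertion_a Pr' X' i rho,
    assertion_b Pr M X i rho -> assertion_b Pr' M' X' i rho,
    assertion_c Pr X i rho -> assertion_c Pr' X' i rho &
    assertion_d Pr X i rho -> assertion_d Pr' X' i rho].
  have ac i : assertions_ac Pr M X i rho -> assertions_ac Pr' M' X' i rho.
    by move=> [/= ha hb hc]; have [Ha Hb Hc _] := H i; split; [exact: Ha|exact: Hb|exact: Hc].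
  have ad i : assertions_ad Pr M X i rho -> assertions_ad Pr' M' X' i rho.
    move=> [/= ha hb hc hd]; have [Ha Hb Hc Hd] := H i.
    by split; [exact: Ha|exact: Hb|exact: Hc|exact: Hd].
  by split => // h i; [exact: ac|exact: ad].
have [mM mX _ _] := mrw; have [mM' mX' _ _] := mrw'.
have [L LE] := path_law_exists i mM mX Pr.
have [L' LE'] := path_law_exists i mM' mX' Pr'.
have LP := markov_random_walk_chain_law mrw LE.
have LP' := markov_random_walk_chain_law mrw' LE'.
have irrL j k : exists n, 0 < prob (L j) [set w : @trajectory R S i | state n w = k].
  have [n hn] := irr j k; exists n; rewrite -lte_fin -probE ?LE//.
  exact: measurable_state.
have kT j k : p j k * fine (K j k setT) = p j k by rewrite probability_setT mulr1.
have pi_gt0 := stationary_gt0 LP kT stat p_ge0 irrL.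
have dual j k A : dual_matrix p pi_ j k * fine (dual_kernel K j k A) =
    pi_ k * (p k j * fine (K k j A)) / pi_ j.
  by rewrite /dual_matrix /dual_kernel; ring.
have pi_neq0 j : pi_ j != 0 by rewrite gt_eqF.
have nontrivL : ~ exists g, null_increments L g.
  move=> [g hg]; apply: nontriv; exists g => n j.
  have mbad := @measurable_increment_neq R S i g n.
  exists (path_of i M X @^-1` [set w | increment n w <> g (state n.+1 w) - g (state n w)]).
  split => //.
  - by rewrite -[X in measurable X]setTI; exact: (measurable_path_of mM mX).
  - by rewrite -LE probE// hg.
have [C hC] := mean_return_time_summable mM mX (LE i) (mrt i).
(* Summability and escape reach the dual by equality of the probabilities concerned, rather than by
   showing that the dual is positive recurrent and nontrivial. *)
have hC' n : \sum_(a < n) prob (L' i) (@avoids R S i i 1 a) <= C.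
  by rewrite (le_trans _ (hC n))//; apply: ler_sum => a _;
    rewrite (prob_avoids_dual LP LP' pi_neq0 dual).
have esc := position_escapes LP irrL (avoids_recurrent hC) nontrivL.
have esc' (e1 e2 : R) : 0 < e2 -> exists N, forall n, (N <= n)%N -> visit_prob L' i n `[- e1, e1] <= e2.
  move=> /(esc e1)[N hN]; exists N => n /hN.
  by rewrite (visit_prob_dual LP LP' pi_neq0 dual).
have small (Q : S -> probability (@trajectory R S i) R) :
    (forall e, 0 < e -> exists N, forall n, (N <= n)%N ->
       prob (Q i) (@sign_differs R S i i n) <= e) ->
    prob (Q i) (@sign_differs R S i i n) @[n --> \oo] --> (0 : R).
  move=> h; apply/cvgr0Pnorm_le => e e0; have [N hN] := h e e0; exists N => // n /hN.
  by rewrite ger0_norm ?prob_ge0.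
have sd := small L (sign_differs_small LP hC esc).
have sd' := small L' (sign_differs_small LP' hC' esc').
have same := embed_law LP LP' (first_return_prob_dual LP LP' pi_neq0 dual i)
  (prob_avoids_dual LP LP' pi_neq0 dual i).
split.
- exact: (assertion_a_transfer mM mX (LE i) mM' mX' (LE' i) same sd sd').
- exact: (assertion_b_transfer (LE i) (LE' i) same).
- exact: (assertion_c_transfer (LE i) (LE' i) same sd sd').
- exact: (assertion_d_transfer (LE i) (LE' i) same sd sd').
Qed.
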